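(* There is an absolute constant $c>0$ with the following property. Let $(X_i)_{i\in\mathbb{N}}$ be a sequence of free (not necessarily identically distributed) bounded self-adjoint random variables with distributions $(\nu_i)_{i\in\mathbb{N}}$ for probability measures $\nu_i$ on $\mathbb{R}$. Assume that $\nu_i$ has mean zero and variance $\sigma_i^2\in(0,\infty)$, $i\in\mathbb{N}$, and that $\operatorname{supp}\nu_i\subset[-T_i,T_i]$ for some $T_i>0$. Define $$B_n=\Big(\sum_{i=1}^n\sigma_i^2\Big)^{1/2},\qquad S_n=\frac{1}{B_n}\sum_{i=1}^nX_i,\qquad L_n=\frac{\sum_{i=1}^nT_i^3}{B_n^3},$$ and let $\mu_{\boxplus n}$ denote the distribution of $S_n$. Then $$\Delta(\mu_{\boxplus n},\omega)\le cL_n.$$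
   Context: $\omega$ is Wigner's semicircle law with mean zero and variance one, i.e. the measure with density $\frac{1}{2\pi}\sqrt{4-x^2}$ on $[-2,2]$. The Kolmogorov distance of probability measures $\nu,\nu'$ on $\mathbb{R}$ is $\Delta(\nu,\nu')=\sup_{x\in\mathbb{R}}|\nu((-\infty,x])-\nu'((-\infty,x])|$. The $X_i$ are bounded self-adjoint random variables in a tracial noncommutative probability space, free in Voiculescu's sense. The distribution of $S_n$ is the free additive convolution $\mu_{\boxplus n}=\mu_1\boxplus\dots\boxplus\mu_n$, where $\mu_i=D_{B_n^{-1}}\nu_i$ is the push-forward of $\nu_i$ under $x\mapsto x/B_n$. Analytically, with $G_\nu(z)=\int\frac{1}{z-t}\nu(dt)$ and $F_\nu=1/G_\nu$ on the upper half-plane $\mathbb{C}^+$, the measure $\mu_1\boxplus\dots\boxplus\mu_n$ is the probability measure $\nu$ with $F_\nu(z)=F_{\mu_1}(Z_1(z))$, where $Z_1,\dots,Z_n:\mathbb{C}^+\to\mathbb{C}^+$ are the unique holomorphic functions with $Z_1(z)+\dots+Z_n(z)-z=(n-1)F_{\mu_1}(Z_1(z))$ and $F_{\mu_1}(Z_1(z))=\dots=F_{\mu_n}(Z_n(z))$ for all $z\in\mathbb{C}^+$. *)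

(* Defs.v *)
From HB Require Import structures.
From mathcomp Require Import all_boot all_order all_algebra.
From mathcomp Require Import complex.
From mathcomp Require Import all_classical all_reals all_analysis.
From mathcomp Require Import measurable_realfun ring lra.
Set Implicit Arguments.
Unset Strict Implicit.
Unset Printing Implicit Defensive.
Import Order.TTheory GRing.Theory Num.Theory.
Import numFieldNormedType.Exports.
Local Open Scope classical_set_scope.
Local Open Scope ring_scope.
Local Open Scope complex_scope.

Section measures_on_the_line.
Context {R : realType}.
Local Notation prob := (probability (measurableTypeR R) R).

Definition msupport (nu : prob) : set R :=
  [set x : R | forall U : set R, open_nbhs x U -> (0 < nu U)%E].

Definition kolmogorov_distance (nu nu' : prob) : \bar R :=
  ereal_sup (range (fun x : R => (`|nu `]-oo, x]%classic - nu' `]-oo, x]%classic|)%E)).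

End measures_on_the_line.

Section semicircle.
Variable R : realType.
Local Notation mu := (@lebesgue_measure R).

(* [Num.sqrt] vanishes on negative reals, so this is zero off [-2, 2]. *)
Definition semicircle_pdf (x : R) : R := (2 * pi)^-1 * Num.sqrt (4 - x ^+ 2).

Lemma semicircle_pdf_ge0 x : 0 <= semicircle_pdf x.
Proof.
by rewrite mulr_ge0 ?sqrtr_ge0// invr_ge0 mulr_ge0 ?pi_ge0.
Qed.

Lemma continuous_semicircle_pdf : continuous semicircle_pdf.
Proof.
move=> x; apply: cvgM; first exact: cvg_cst.
apply: (@continuous_comp _ _ _ (fun y : R => 4 - y ^+ 2) Num.sqrt); last first.
  exact: sqrt_continuous.
by apply: cvgB; [exact: cvg_cst|exact: exprn_continuous].
Qed.

Lemma measurable_semicircle_pdf : measurable_fun setT semicircle_pdf.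
Proof. exact: (continuous_measurable_fun continuous_semicircle_pdf). Qed.

Definition semicircle : set (measurableTypeR R) -> \bar R :=
  fun U => (\int[mu]_(x in U) (semicircle_pdf x)%:E)%E.

Let semicircle0 : semicircle set0 = 0%E.
Proof. by rewrite /semicircle integral_set0. Qed.

Let semicircle_ge0 U : (0 <= semicircle U)%E.
Proof. by apply: integral_ge0 => x _; rewrite lee_fin semicircle_pdf_ge0. Qed.

Let semicircle_sigma_additive : semi_sigma_additive semicircle.
Proof.
move=> /= F mF tF mUF; rewrite /semicircle; apply: cvg_toP.
  apply: ereal_nondecreasing_is_cvgn => m n mn.
  apply: lee_sum_nneg_natr => // k _ _.
  by apply: integral_ge0 => /= x Fkx; rewrite lee_fin semicircle_pdf_ge0.
rewrite ge0_integral_bigcup//=.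
- apply: measurable_funTS; apply: measurableT_comp => //.
  exact: measurable_semicircle_pdf.
- by move=> x _; rewrite lee_fin semicircle_pdf_ge0.
Qed.

HB.instance Definition _ := isMeasure.Build _ _ _ semicircle
  semicircle0 semicircle_ge0 semicircle_sigma_additive.

Let F (t : R) : R := 2 * sin t.
Let H (t : R) : R := pi^-1 * (t + sin t * cos t).

Let is_deriveF (t : R) : is_derive t 1 F (2 * cos t).
Proof. by rewrite /F; apply: is_derive_eq; rewrite /GRing.scale/=. Qed.

Let is_deriveH (t : R) : is_derive t 1 H (2 * pi^-1 * cos t ^+ 2).
Proof.
rewrite /H; apply: is_derive_eq; rewrite /GRing.scale/=.
have c2 := cos2Dsin2 t.
have {c2} -> : sin t * - sin t = cos t ^+ 2 - 1 by rewrite -c2; ring.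
ring.
Qed.

Let derive1F : derive1 F = (fun t => 2 * cos t).
Proof. by apply/funext => t; rewrite derive1E; apply: derive_val. Qed.

Let semicircle_setT : semicircle setT = 1%E.
Proof.
have pi0 := pi_gt0 R.
have alg1 (p u : R) : 0 < p ->
    (2 * p)^-1 * (2 * u) * (2 * u) = 2 * p^-1 * u ^+ 2.
  by move=> p0; field; rewrite gt_eqF.
have alg2 (p : R) : 0 < p -> p^-1 * (p / 2) - p^-1 * - (p / 2) = 1.
  by move=> p0; field; rewrite gt_eqF.
have cF' : continuous (fun t : R => 2 * cos t).
  by move=> t; apply: cvgM; [exact: cvg_cst|exact: continuous_cos].
have cF : continuous F.
  by move=> t; apply: cvgM; [exact: cvg_cst|exact: continuous_sin].
have cH : continuous H.
  move=> t; apply: cvgM; first exact: cvg_cst.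
  apply: cvgD; first exact: cvg_id.
  by apply: cvgM; [exact: continuous_sin|exact: continuous_cos].
have LR (G : R -> R) (a b : R) : (forall t, derivable G t 1) -> continuous G ->
    derivable_oo_LRcontinuous G a b.
  move=> dG cG; split => [x _||]; first exact: dG.
    exact: cvg_at_right_filter (cG a).
  exact: cvg_at_left_filter (cG b).
have FNE : F (- (pi / 2)) = -2 by rewrite /F sinN sin_pihalf mulrN1.
have FE : F (pi / 2) = 2 by rewrite /F sin_pihalf mulr1.
have -> : semicircle setT = (\int[mu]_(x in `[F (- (pi / 2))%R, F (pi / 2)%R]) (semicircle_pdf x)%:E)%E.
  rewrite FNE FE [RHS]integral_mkcond; apply: eq_integral => x _.
  rewrite patchE; case: ifPn => //; rewrite notin_setE/= in_itv/= => x2.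
  rewrite /semicircle_pdf ler0_sqrtr ?mulr0//.
  by move/negP: x2; rewrite negb_and -!ltNge => /orP[]; nra.
rewrite (@integration_by_substitution_increasing _ F).
- rewrite derive1F.
  transitivity (\int[mu]_(t in `[(- (pi / 2))%R, (pi / 2)%R])
      (2 * pi^-1 * cos t ^+ 2)%:E)%E.
    apply: eq_integral => t; rewrite inE/= in_itv/= => tpi; congr EFin.
    rewrite /semicircle_pdf /F /= mulrfctE /=.
    have -> : 4 - (2 * sin t) ^+ 2 = (2 * cos t) ^+ 2.
      by rewrite [in RHS]exprMn cos2sin2; ring.
    rewrite sqrtr_sqr ger0_norm ?mulr_ge0 ?cos_ge0_pihalf//.
    by rewrite alg1.
  rewrite (@continuous_FTC2 _ _ H).
  + rewrite /H cosN cos_pihalf !mulr0 !addr0 -EFinB; congr EFin.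
    by rewrite alg2.
  + lra.
  + apply: continuous_subspaceT => t; apply: cvgM; first exact: cvg_cst.
    apply: (@continuous_comp _ _ _ cos (fun y : R => y ^+ 2)).
      exact: continuous_cos.
    exact: exprn_continuous.
  + exact: LR.
  + by move=> t _; rewrite derive1E; apply: derive_val.
- lra.
- by move=> x y xI yI xy; rewrite /F ltr_pM2l// ltr_sin.
- by move=> t _; rewrite derive1F; exact: cF'.
- by rewrite derive1F; apply/cvg_ex; eexists; apply: cvg_at_right_filter; exact: cF'.
- by rewrite derive1F; apply/cvg_ex; eexists; apply: cvg_at_left_filter; exact: cF'.
- exact: LR.
- by apply: continuous_subspaceT; exact: continuous_semicircle_pdf.
Qed.

HB.instance Definition _ := @Measure_isProbability.Build _ _ R
  semicircle semicircle_setT.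

End semicircle.

(* A *-probability space with a tracial state. Only the *-algebra generated by
   the random variables matters, so no topology is put on the algebra: von
   Neumann algebras with a trace are instances. *)
Record tracial_space (R : realType) := TracialSpace {
  carrier :> algType R[i] ;
  star : carrier -> carrier ;
  state : {scalar carrier} ;
  starD : {morph star : x y / x + y} ;
  starZ : forall (a : R[i]) x, star (a *: x) = (a^*)%C *: star x ;
  starM : forall x y, star (x * y) = star y * star x ;
  starK : involutive star ;
  state1 : state 1 = 1 ;
  state_ge0 : forall x, 0 <= state (star x * x) ;
  state_trace : forall x y, state (x * y) = state (y * x)
}.

Section random_variables.
Context {R : realType} {A : tracial_space R}.

Definition self_adjoint (x : A) : Prop := star x = x.

(* Freeness of the unital algebras generated by the [X i], whose elements are
   the polynomials in [X i]; a word is a list of pairs (index, polynomial). *)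
Definition freely_independent (X : nat -> A) : Prop :=
  forall w : seq (nat * {poly R[i]}),
    w != [::] ->
    sorted (fun u v => u.1 != v.1) w ->
    (forall u, u \in w -> state A (horner_alg (X u.1) u.2) = 0) ->
    state A (\prod_(u <- w) horner_alg (X u.1) u.2) = 0.

(* The distribution of a bounded self-adjoint element: the compactly supported
   probability measure with the same moments, unique when it exists. *)
Definition has_distribution (x : A)
    (nu : probability (measurableTypeR R) R) : Prop :=
  compact (msupport nu) /\
  forall k : nat, state A (x ^+ k) = (\int[nu]_t (t ^+ k))%:C.

End random_variables.

(* Main.v *)
Require Import Defs.
From HB Require Import structures.
From mathcomp Require Import all_boot all_order all_algebra.
From mathcomp Require Import complex.
From mathcomp Require Import all_classical all_reals all_analysis.
From mathcomp Require Import measurable_realfun zify ring lra.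

(** The free cumulants r_k of a standardized compactly supported measure mu are
    encoded by polynomials p_k whose generating series is 1 / (1 + g R(g) - g t),
    with R the generating series of r; all p_k with k > 0 have mean 0 under mu.
    Freeness makes cumulants additive (all_wordsS): with the summed cumulants, p_k
    at a free sum is the sum of the centred alternating words of degree k, which
    have state 0. A variable bounded by T has cumulants growing at most like
    (4 T) ^ k (free_cumulant_le), so that after normalization the cumulants of the
    sum are those of the semicircle law up to kappa 8 ^ -k, where kappa is a
    multiple of L (sum_cumulant_near).

    The analytic part compares mu with the semicircle law for small kappa. With
    K(g) = 1/g + R(g), the Cauchy transform of mu at K(g) is g for |g| small. This
    persists for all |g| < 1 / (1 + kappa) with Im g < 0: the Gram matrix of the
    p_k in L^2(mu) satisfies a convolution recursion (gramE), which bounds the norm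
    of p_k by (1 + kappa) ^ k, so the partial sums of the generating series invert
    g (K(g) - t) up to an error that tends to 0 in L^1(mu) (expect_resolvent).

    Integrating the Cauchy transform along the rays s g gives the mean of
    arg (z - t) at z = K(g), up to a fixed function of g, as the imaginary part of
    an explicit power series (potential_ktransform). For mu and for the semicircle
    law these series differ by at most kappa, and the points K(g) and g + 1/g
    differ by at most kappa; hence within kappa of any given point at height 4 kappa
    there is a z at which the two means of arg (z - t) differ by at most 3 kappa
    (potential_close).

    Finally arg (z - t) / pi is an average of indicator functions at the quantiles
    of the Cauchy law of scale Im z, so the same bound holds for an average of the
    difference of the distribution functions. As one of them is monotone and the
    other Lipschitz, a bound D for the difference improves to D / 3 plus a multiple
    of kappa, and iteration gives a multiple of kappa (distrib_fun_close). *)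

Set Implicit Arguments.
Unset Strict Implicit.
Unset Printing Implicit Defensive.
Import Order.TTheory GRing.Theory Num.Theory.
Import numFieldNormedType.Exports.
Local Open Scope classical_set_scope.
Local Open Scope ring_scope.
Local Open Scope complex_scope.

Local Notation cnorm := ComplexField.Normc.normc.
Local Notation Re := complex.Re.
Local Notation Im := complex.Im.

(** * Polynomials attached to a sequence of free cumulants *)

Section cumulant_polynomials.
Context {R : comNzRingType}.
Implicit Types (r : nat -> R) (E : {scalar {poly R}}).

Fixpoint cumulant_table r k : seq {poly R} :=
  if k is k'.+1 then
    let s := cumulant_table r k' in
    ('X * s`_0 - \sum_(j < k'.+1) r j *: s`_j) :: s
  else [:: 1].

(** The generating series of these polynomials in g is the inverse of
    1 + g R(g) - g t, where R is the generating series of r: it is the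
    resolvent 1 / (K(g) - t), divided by g, at the point K(g) = 1/g + R(g). *)
Definition cumulant_poly r k : {poly R} := locked ((cumulant_table r k)`_0).

Lemma nth_cumulant_table r k j : (j <= k)%N ->
  (cumulant_table r k)`_j = cumulant_poly r (k - j).
Proof.
by elim: k j => [|k IH] [|j] //= jk; rewrite ?subSS -?IH// /cumulant_poly -lock.
Qed.

Lemma cumulant_poly0 r : cumulant_poly r 0 = 1.
Proof. by rewrite /cumulant_poly -lock. Qed.

Lemma cumulant_polyS r k : cumulant_poly r k.+1 =
  'X * cumulant_poly r k - \sum_(j < k.+1) r j *: cumulant_poly r (k - j).
Proof.
rewrite {1}/cumulant_poly -lock /=; congr ('X * _ - _).
  by rewrite nth_cumulant_table ?subn0.
by apply: eq_bigr => j _; rewrite nth_cumulant_table// -ltnS.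
Qed.

Lemma mulX_cumulant_poly r k : 'X * cumulant_poly r k =
  cumulant_poly r k.+1 + \sum_(j < k.+1) r j *: cumulant_poly r (k - j).
Proof. by rewrite cumulant_polyS subrK. Qed.

Fixpoint free_table E k : seq {poly R} :=
  if k is k'.+1 then
    let s := free_table E k' in
    ('X * s`_0 - \sum_(j < k'.+1) E ('X * s`_(k' - j)) *: s`_j) :: s
  else [:: 1].

(** The recursion for the polynomials attached to r uses r j only below the
    current index, so r can be chosen along with them, in the only way that makes E
    vanish on those of positive index when E 1 = 1. Index 0 is the mean and index 1
    the variance. *)
Definition free_cumulant E k : R := E ('X * (free_table E k)`_0).

Lemma nth_free_table E k j : (j <= k)%N ->
  (free_table E k)`_j = cumulant_poly (free_cumulant E) (k - j).
Proof.
have [n] := ubnP k; elim: n k j => // n IH [|k] [|j] // kn jk; first by rewrite cumulant_poly0.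
  2: by rewrite /= IH.
rewrite subn0 cumulant_polyS /=; congr (_ - _).
  by rewrite (IH k 0%N)// subn0.
apply: eq_bigr => i _; have ik : (i <= k)%N by rewrite -ltnS.
rewrite (IH k i)//; congr (_ *: _); rewrite /free_cumulant (IH k)// ?leq_subr//.
by rewrite subKn// IH ?subn0//; apply: leq_ltn_trans ik _.
Qed.

Lemma free_cumulantE E k :
  free_cumulant E k = E ('X * cumulant_poly (free_cumulant E) k).
Proof. by rewrite {1}/free_cumulant nth_free_table// subn0. Qed.

Lemma free_cumulant_null E k : E 1 = 1 ->
  E (cumulant_poly (free_cumulant E) k.+1) = 0.
Proof.
move=> E1; have [n] := ubnP k; elim: n k => // n IH k kn.
rewrite cumulant_polyS linearB linear_sum/= -free_cumulantE big_ord_recr/= subnn.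
rewrite cumulant_poly0 linearZ/= E1 big1 ?add0r ?[X in _ - X]mulr1 ?subrr// => j _.
have jk := ltn_ord j; rewrite linearZ/= -[X in cumulant_poly _ X]prednK ?subn_gt0//.
by rewrite IH ?[LHS]mulr0//; lia.
Qed.

End cumulant_polynomials.

(** * Gram matrix of the cumulant polynomials *)

Section gram.
Context {R : comNzRingType}.
Variables (E : {scalar {poly R}}) (r : nat -> R).
Hypothesis E0 : forall k, E (cumulant_poly r k.+1) = 0.
Local Notation p := (cumulant_poly r).

Let mulX_left k l : E ('X * p k * p l) =
  E (p k.+1 * p l) + \sum_(j < k.+1) r j * E (p (k - j) * p l).
Proof.
rewrite mulX_cumulant_poly mulrDl linearD/= mulr_suml linear_sum/=.
congr (_ + _); apply: eq_bigr => j _.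
by rewrite -scalerAl linearZ.
Qed.

Let gram_shift k l : E (p k * p l.+1) =
  E (p k.+1 * p l) + \sum_(j < k.+1) r j * E (p (k - j) * p l)
  - \sum_(j < l.+1) r j * E (p k * p (l - j)).
Proof.
rewrite -mulX_left -mulrA mulrCA [in RHS]mulX_cumulant_poly mulrDr linearD.
rewrite mulr_sumr linear_sum/= -addrA.
under eq_bigr do rewrite -scalerAr linearZ/=.
by rewrite subrr addr0.
Qed.

(** In generating functions, with f_x = x (K(x) - t): the resolvent identity gives
    E[1 / (f_x f_y)] = (x - y) / (x y (K(y) - K(x))), that is
    1 / (1 - x y (R(x) - R(y)) / (x - y)). *)
Lemma gramE k l : E (p k.+1 * p l.+1) =
  \sum_(c < k.+1) \sum_(d < l.+1) r (c + d).+1 * E (p (k - c) * p (l - d)).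
Proof.
elim: l k => [|l IH] k; rewrite gram_shift ?cumulant_poly0.
  rewrite big_ord1 !mulr1 !E0 mulr0 subr0 add0r big_ord_recl/=.
  rewrite subn0 mulr1 E0 mulr0 add0r; apply: eq_bigr => c _.
  by rewrite big_ord1 addn0 mulr1 /bump/= add1n subSS.
rewrite IH big_ord_recl [X in _ + X - _]big_ord_recl.
rewrite [X in _ - X]big_ord_recl /= !subn0.
under [RHS]eq_bigr do rewrite big_ord_recl/= addn0 subn0.
rewrite big_split/=.
set a := (X in X + _ + (_ + _) - (_ + _) = _ + _).
set b := (X in _ + X + (_ + _) - (_ + _) = _ + _).
set d := (X in _ + _ + (_ + X) - (_ + _) = _ + _).
set e := (X in _ + _ + (_ + _) - (_ + X) = _ + _).
set f := (X in _ + _ + (_ + _) - (_ + _) = X + _).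
set g := (X in _ + _ + (_ + _) - (_ + _) = _ + X).
have -> : a = e by apply: eq_bigr => i _; rewrite /bump/= add0n add1n subSS.
have -> : d = f by apply: eq_bigr => i _; rewrite /bump/= add1n subSS.
have -> : b = g.
  apply: eq_bigr => i _; apply: eq_bigr => j _.
  by rewrite /bump/= !add1n !subSS addSn addnS.
ring.
Qed.

End gram.

Section gram_bound.
Context {R : realFieldType}.
Variables (E : {scalar {poly R}}) (r : nat -> R) (B : R).
Hypothesis E1 : E 1 = 1.
Hypothesis E0 : forall k, E (cumulant_poly r k.+1) = 0.
Hypothesis B1 : 1 <= B.
Hypothesis rB : forall k l,
  \sum_(c < k) \sum_(d < l) `|r (c + d).+1| <= B ^+ 2.

(** In the recursion gramE the entries on the right have index sum at most
    k + l - 2, and the gained factor B ^ 2 absorbs the sum of the coefficients. *)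
Lemma gram_le k l :
  `|E (cumulant_poly r k * cumulant_poly r l)| <= B ^+ (k + l).
Proof.
have B0 : 0 <= B := le_trans ler01 B1.
have [n] := ubnP (k + l); elim: n k l => // n IH [|k] [|l] kln.
- by rewrite cumulant_poly0 mulr1 E1 normr1.
- by rewrite cumulant_poly0 mul1r E0 normr0 exprn_ge0.
- by rewrite cumulant_poly0 mulr1 E0 normr0 exprn_ge0.
rewrite (gramE E0) (le_trans (ler_norm_sum _ _ _))//.
have -> : B ^+ (k.+1 + l.+1) = B ^+ 2 * B ^+ (k + l).
  by rewrite -exprD; congr (_ ^+ _); lia.
apply: (@le_trans _ _ (\sum_(c < k.+1) \sum_(d < l.+1)
    `|r (c + d).+1| * B ^+ (k + l))).
  apply: ler_sum => c _; apply: le_trans (ler_norm_sum _ _ _) _.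
  apply: ler_sum => d _; rewrite normrM ler_wpM2l//.
  have := ltn_ord c; have := ltn_ord d => dl ck.
  by apply: le_trans (IH _ _ _) _; [lia|apply: ler_weXn2l => //; lia].
under eq_bigr do rewrite -mulr_suml.
by rewrite -mulr_suml ler_wpM2r// exprn_ge0.
Qed.

End gram_bound.

(** * Sums of free random variables *)

Lemma triangle_sum (V : nmodType) (m : nat) (G : nat -> nat -> nat -> V) :
  \sum_(l < m.+1) \sum_(j < l.+1) G j (l - j)%N (m - l)%N =
  \sum_(j < m.+1) \sum_(a < (m - j).+1) G j a (m - j - a)%N.
Proof.
elim: m G => [|m IH] G; first by rewrite !big_ord1.
rewrite big_ord_recl big_ord1 [RHS]big_ord_recl !subn0.
under eq_bigr => i _ do rewrite lift0 big_ord_recl subSS subn0.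
rewrite big_split/= addrA; congr (_ + _).
  by rewrite [RHS]big_ord_recl subn0; congr (_ + _); apply: eq_bigr => i _.
rewrite -(IH (fun j => G j.+1)); apply: eq_bigr => i _.
by apply: eq_bigr => j _; rewrite /bump/= add1n subSS.
Qed.

Section free_words.
Context {R : realType} {A : tracial_space R}.
Variables (X : nat -> A) (n : nat) (p : nat -> nat -> {poly R[i]}).
Hypothesis freeX : freely_independent X.
Hypothesis p_null : forall i k, state A (horner_alg (X i) (p i k.+1)) = 0.

Local Notation x i k := (horner_alg (X i) (p i k)).

Fixpoint word_table k : seq (nat -> A) :=
  if k is k'.+1 then
    let s := word_table k' in
    (fun i => \sum_(l < k') x i l.+1 *
       ((l.+1 == k')%:R + \sum_(j < n | j != i :> nat) nth (fun=> 0) s l j)) :: s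
  else [::].

(** The sum of all the products x i1 k1 * ... * x im km with neighbouring
    indices distinct, first index i and total degree k. *)
Definition words (i k : nat) : A := nth (fun=> 0) (word_table k.+1) 0 i.

Definition words_avoiding (i k : nat) : A :=
  (k == 0%N)%:R + \sum_(j < n | j != i :> nat) words j k.

Definition all_words (k : nat) : A := (k == 0%N)%:R + \sum_(j < n) words j k.

Lemma nth_word_table k l i : (l < k)%N ->
  nth (fun=> 0) (word_table k) l i = words i (k - l.+1).
Proof. by elim: k l => [|k IH] [|l] //= lk; rewrite ?subn1 // IH ?subSS. Qed.

Lemma wordsE i k :
  words i k = \sum_(l < k) x i l.+1 * words_avoiding i (k - l.+1).
Proof.
rewrite {1}/words /=; apply: eq_bigr => l _; congr (_ * (_ + _)).
  by congr (_%:R); have := ltn_ord l; lia.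
by apply: eq_bigr => j _; rewrite nth_word_table.
Qed.

(** The first letter of a word goes over to the prefix, by induction on the degree;
    once nothing is left, the prefix is itself a centred alternating word. *)
Lemma state_prefix_words (w : seq (nat * {poly R[i]})) i k :
  sorted (fun a b => a != b) (rcons (map fst w) i) ->
  (forall u, u \in w -> state A (horner_alg (X u.1) u.2) = 0) ->
  state A (\prod_(u <- w) horner_alg (X u.1) u.2 * words i k) = 0.
Proof.
have [m] := ubnP k; elim: m w i k => // m IH w i k km ws w0.
rewrite wordsE mulr_sumr linear_sum big1// => l _.
have lk := ltn_ord l.
set w' := rcons w (i, p i l.+1).
have w's : sorted (fun a b => a != b) (map fst w') by rewrite map_rcons.
have w'0 u : u \in w' -> state A (horner_alg (X u.1) u.2) = 0.
  by rewrite mem_rcons in_cons => /predU1P[->|/w0 //]; exact: p_null.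
have -> : \prod_(u <- w) horner_alg (X u.1) u.2 *
    (x i l.+1 * words_avoiding i (k - l.+1)) =
    \prod_(u <- w') horner_alg (X u.1) u.2 * words_avoiding i (k - l.+1).
  by rewrite /w' big_rcons/= mulrA.
rewrite /words_avoiding mulrDr linearD/= mulr_sumr linear_sum/= [X in _ + X]big1 => [|j ji].
  rewrite addr0 mulr_natr linearMn/=.
  by rewrite freeX ?mul0rn// /w'; [case: (w)|rewrite sorted_map in w's].
apply: IH => //; first by lia.
rewrite /w' map_rcons/= -!cats1 -catA/=.
move: w's; rewrite /w' map_rcons/=; case: (map fst w) => [|a s] /=.
  by rewrite eq_sym ji.
by rewrite -cats1 !cat_path/= => /andP[-> /andP[-> _]]; rewrite eq_sym ji.
Qed.

Lemma state_all_words k : state A (all_words k.+1) = 0.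
Proof.
rewrite /all_words add0r linear_sum big1// => j _.
by have := @state_prefix_words [::] j k.+1; rewrite big_nil mul1r; apply.
Qed.

Variable r : nat -> nat -> R[i].
Hypothesis x0 : forall i, x i 0 = 1.
Hypothesis xS : forall i k,
  X i * x i k = x i k.+1 + \sum_(j < k.+1) r i j *: x i (k - j).

Let all_words_split (i : 'I_n) k :
  all_words k = \sum_(l < k.+1) x i l * words_avoiding i (k - l).
Proof.
rewrite big_ord_recl x0 mul1r subn0 -wordsE /all_words (bigD1 i)//= addrCA addrC.
by rewrite /words_avoiding.
Qed.

(** Write P_i(g) for the generating series of the centred letters of index i and
    U_i(g) for that of the words not starting with i. All words have the series
    W = P_i U_i, those starting with i have (P_i - 1) U_i, and
    g (X_i - R_i(g)) P_i = P_i - 1; summing over i gives g (Y - R(g)) W = W - 1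
    for Y the sum of the X_i and R that of the R_i. *)
Lemma all_wordsS k : all_words k.+1 = (\sum_(i < n) X i) * all_words k -
  \sum_(j < k.+1) (\sum_(i < n) r i j) *: all_words (k - j).
Proof.
have XW (i : 'I_n) : X i * all_words k =
    words i k.+1 + \sum_(j < k.+1) r i j *: all_words (k - j).
  rewrite (all_words_split i) mulr_sumr.
  under eq_bigr do rewrite mulrA xS mulrDl.
  rewrite big_split/= wordsE; congr (_ + _).
  under eq_bigr do rewrite mulr_suml.
  rewrite (triangle_sum k
    (fun j a b => r i j *: x i a * words_avoiding i b)).
  apply: eq_bigr => j _; rewrite (all_words_split i) scaler_sumr.
  by apply: eq_bigr => l _; rewrite scalerAl.
rewrite mulr_suml; under [X in _ = X - _]eq_bigr do rewrite XW.
rewrite big_split/= {1}/all_words add0r [X in _ = _ + X - _]exchange_big/=.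
by under [X in _ = _ - X]eq_bigr do rewrite scaler_suml; rewrite addrK.
Qed.

End free_words.

(** * Size of the free cumulants of a bounded variable *)

Lemma ler_sum_widen (R : numDomainType) (m n : nat) (b : nat -> R) :
  (forall k, 0 <= b k) -> (m <= n)%N -> \sum_(k < m) b k <= \sum_(k < n) b k.
Proof.
move=> b0 mn; rewrite -(subnKC mn) big_split_ord/= lerDl.
by apply: sumr_ge0.
Qed.

Lemma convolution_le (R : numDomainType) (a b : nat -> R) n :
  (forall k, 0 <= a k) -> (forall k, 0 <= b k) ->
  \sum_(k < n) \sum_(j < k.+1) a j * b (k - j)%N <=
  (\sum_(k < n) a k) * (\sum_(k < n) b k).
Proof.
move=> a0 b0; case: n => [|n]; first by rewrite !big_ord0 mul0r.
rewrite (triangle_sum n (fun j c _ => a j * b c)) mulr_suml; apply: ler_sum => j _.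
rewrite -mulr_sumr ler_wpM2l//; apply: ler_sum_widen => //.
by have := ltn_ord j; lia.
Qed.

Section cumulant_bound.
Context {R : realFieldType}.
Variables (E : {scalar {poly R}}) (T s : R).
Hypothesis T0 : 0 < T.
Hypothesis s0 : 0 <= s.
Hypothesis sT : s <= T ^+ 2.
Hypothesis EX : E 'X = 0.
Hypothesis EX2 : forall (q : {poly R}) (C : R),
  (forall t : R, `|t| <= T -> `|q.[t]| <= C) -> `|E ('X * ('X * q))| <= s * C.

Local Notation r := (free_cumulant E).
Local Notation p := (cumulant_poly (free_cumulant E)).

Let free_cumulant0 : r 0 = 0.
Proof. by rewrite free_cumulantE cumulant_poly0 mulr1. Qed.

Let free_cumulantS k :
  r k.+1 = E ('X * ('X * p k)) - \sum_(j < k.+1) r j * r (k - j).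
Proof.
rewrite free_cumulantE cumulant_polyS mulrBr linearB mulr_sumr linear_sum/=.
congr (_ - _); apply: eq_bigr => j _.
by rewrite -scalerAr linearZ/= -free_cumulantE.
Qed.

(** With x = 1/(4T), both generating series at x obey quadratic inequalities,
    P <= 1 + x T P + x A P and A <= x s P + x A^2, and these keep the bounds
    P <= 8/5 and A <= s/(2T) through the induction on the number of terms. *)
Let generating_le n :
  \sum_(k < n) `|r k| * (4 * T)^-1 ^+ k <= s / (2 * T) /\
  forall t, `|t| <= T ->
    \sum_(k < n) `|(p k).[t]| * (4 * T)^-1 ^+ k <= 8 / 5.
Proof.
have [hT hs hsT] := And3 T0 s0 sT; set x := (4 * T)^-1.
have x0 : 0 < x by rewrite invr_gt0; lra.
have xT : x * T = 4^-1 by rewrite /x; field; rewrite gt_eqF.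
have sx : s / (2 * T) = 2 * x * s by rewrite /x; field; rewrite gt_eqF.
have xxs : x * (x * s) <= 16^-1.
  have -> : 16^-1 = (x * T) ^+ 2 :> R by rewrite xT; field.
  by rewrite exprMn expr2 -mulrA ler_pM2l// ler_pM2l.
have xs0 : 0 <= x * s by rewrite mulr_ge0// ltW.
have a0 k : 0 <= `|r k| * x ^+ k by rewrite mulr_ge0// exprn_ge0// ltW.
have b0 t k : 0 <= `|(p k).[t]| * x ^+ k by rewrite mulr_ge0// exprn_ge0// ltW.
elim: n => [|n [IHA IHP]].
  by rewrite big_ord0 divr_ge0//; [split=> // t _; rewrite big_ord0|lra].
split=> [|t tT]; last first.
  have {}IHP := IHP t tT.
  have Pn0 : 0 <= \sum_(k < n) `|(p k).[t]| * x ^+ k by apply: sumr_ge0.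
  have An0 : 0 <= \sum_(k < n) `|r k| * x ^+ k by apply: sumr_ge0.
  rewrite big_ord_recl cumulant_poly0 hornerC normr1 mul1r expr0.
  have : \sum_(k < n) `|(p (lift ord0 k)).[t]| * x ^+ lift ord0 k <=
      x * T * (\sum_(k < n) `|(p k).[t]| * x ^+ k) +
      x * ((\sum_(k < n) `|r k| * x ^+ k) * (\sum_(k < n) `|(p k).[t]| * x ^+ k)).
    apply: le_trans (lerD (lexx _) (ler_wpM2l (ltW x0) (convolution_le n a0 (b0 t)))).
    rewrite !mulr_sumr -big_split/=; apply: ler_sum => k _.
    rewrite /bump/= add1n cumulant_polyS hornerD hornerN hornerM hornerX.
    rewrite exprS mulrCA -[x * T * _]mulrA -mulrDr.
    rewrite ler_pM2l//; apply: (@le_trans _ _ ((`|t| * `|(p k).[t]| +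
        \sum_(j < k.+1) `|r j| * `|(p (k - j)).[t]|) * x ^+ k)).
      apply: ler_wpM2r; first by rewrite exprn_ge0// ltW.
    rewrite (le_trans (ler_normB _ _))// normrM lerD2l.
      rewrite horner_sum (le_trans (ler_norm_sum _ _ _))//.
      by apply: ler_sum => j _; rewrite hornerZ normrM.
    rewrite mulrDl mulrA lerD//.
      by rewrite -!mulrA ler_wpM2r// mulr_ge0// exprn_ge0// ltW.
    rewrite mulr_suml; apply: ler_sum => j _.
    have jk : (j <= k)%N by rewrite -ltnS.
    by rewrite -[in x ^+ k](subnKC jk) exprD mulrACA.
  move: IHA IHP Pn0 An0; rewrite xT sx.
  set P := \sum_(k < n) `|(p k).[t]| * _; set Q := \sum_(k < n) `|r k| * _.
  set S := \sum_(k < n) _; move=> QI PI P0 Q0.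
  have : x * (Q * P) <= 8^-1 * P.
    rewrite mulrA ler_wpM2r//; apply: le_trans (ler_wpM2l (ltW x0) QI) _; lra.
  lra.
have An0 : 0 <= \sum_(k < n) `|r k| * x ^+ k by apply: sumr_ge0.
rewrite big_ord_recl free_cumulant0 normr0 mul0r add0r.
(* Signs turn the sum of moduli into E of X ^ 2 times one bounded polynomial. *)
pose e k := Num.sg (E ('X * ('X * p k))) * x ^+ k.
have : \sum_(k < n) `|r (lift ord0 k)| * x ^+ lift ord0 k <=
      x * (s * (8 / 5)) +
      x * ((\sum_(k < n) `|r k| * x ^+ k) * (\sum_(k < n) `|r k| * x ^+ k)).
  have key : \sum_(k < n) `|E ('X * ('X * p k))| * x ^+ k <= s * (8 / 5).
    have -> : \sum_(k < n) `|E ('X * ('X * p k))| * x ^+ k =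
        E ('X * ('X * \sum_(k < n) e k *: p k)).
      rewrite !mulr_sumr linear_sum/=; apply: eq_bigr => k _.
      by rewrite -!scalerAr linearZ/= /e normrEsg; ring.
    apply: le_trans (ler_norm _) _; apply: EX2 => t tT.
    rewrite horner_sum (le_trans (ler_norm_sum _ _ _))//.
    apply: le_trans (IHP t tT); apply: ler_sum => k _.
    have xk0 : 0 <= x ^+ k by rewrite exprn_ge0// ltW.
    rewrite hornerZ normrM mulrC; apply: ler_wpM2l => //.
    rewrite /e normrM (ger0_norm xk0) normr_sg.
    by case: eqP => _; rewrite ?mul0r ?mul1r.
  apply: le_trans (lerD (ler_wpM2l (ltW x0) key)
    (ler_wpM2l (ltW x0) (convolution_le n a0 a0))).
  rewrite !mulr_sumr -big_split/=; apply: ler_sum => k _.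
  rewrite /bump/= add1n free_cumulantS exprS mulrCA -mulrDr ler_pM2l//.
  apply: (@le_trans _ _ ((`|E ('X * ('X * p k))| +
      \sum_(j < k.+1) `|r j| * `|r (k - j)|) * x ^+ k)).
    apply: ler_wpM2r; first by rewrite exprn_ge0// ltW.
    rewrite (le_trans (ler_normB _ _))// lerD2l.
    rewrite (le_trans (ler_norm_sum _ _ _))//.
    by apply: ler_sum => j _; rewrite normrM.
  rewrite mulrDl lerD2l mulr_suml; apply: ler_sum => j _.
  have jk : (j <= k)%N by rewrite -ltnS.
  by rewrite -[in x ^+ k](subnKC jk) exprD mulrACA.
move: IHA An0; rewrite sx.
set Q := \sum_(k < n) `|r k| * _; set S := \sum_(k < n) _; move=> QI Q0.
have : x * (Q * Q) <= 4^-1 * (x * s).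
  have h : x * Q <= 8^-1 by apply: le_trans (ler_wpM2l (ltW x0) QI) _; lra.
  by have := ler_wpM2r Q0 h => /=; lra.
lra.
Qed.

Lemma free_cumulant_le k : `|r k| <= s / (2 * T) * (4 * T) ^+ k.
Proof.
have [+ _] := generating_le k.+1; rewrite big_ord_recr/= => h.
rewrite -ler_pdivrMr ?exprn_gt0 ?mulr_gt0// -exprVn.
apply: le_trans h; rewrite lerDr; apply: sumr_ge0 => i _.
by rewrite mulr_ge0// exprn_ge0// invr_ge0 mulr_ge0// ltW.
Qed.

End cumulant_bound.

(** * Expectations under a measure carried by a bounded interval *)

Section carried.
Context {R : realType}.
Local Notation prob := (probability (measurableTypeR R) R).

Definition carried (mu : prob) (M : R) := mu (~` `[- M, M]%classic) = 0%E.

(** Every point off the support has a null neighbourhood with rational ends, so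
    the complement of the support is a countable union of null sets. *)
Lemma carried_msupport (mu : prob) (M : R) :
  msupport mu `<=` `[- M, M] -> carried mu M.
Proof.
move=> sM.
pose J (ab : rat * rat) : set R := `]ratr ab.1, ratr ab.2[%classic.
pose C k : set R := if unpickle k is Some ab then
  if mu (J ab) == 0%E then J ab else set0 else set0.
have C0 k : mu.-negligible (C k).
  rewrite /C; case: unpickle => [ab|]; last exact: negligible_set0.
  case: eqP => [m0|_]; last exact: negligible_set0.
  by apply/negligibleP => //; exact: measurable_itv.
apply/negligibleP; first by apply: measurableC; exact: measurable_itv.
apply: negligibleS (negligible_bigcup C0) => x /= xM.
have : ~ msupport mu x by move=> /sM.
move=> /existsNP[U /not_implyP[[oU Ux] /negP]].
rewrite -leNgt => U0.
have /nbhs_ballP[e /= e0 eU] : nbhs x U by exact: open_nbhs_nbhs.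
have xe : x - e < x by rewrite ltrBlDr ltrDl.
have ex : x < x + e by rewrite ltrDl.
have [a] := rat_in_itvoo xe.
rewrite in_itv/= => /andP[ax1 ax2].
have [b] := rat_in_itvoo ex.
rewrite in_itv/= => /andP[bx1 bx2].
have JU : J (a, b) `<=` U.
  move=> y; rewrite /J/= in_itv/= => /andP[ay yb]; apply: eU.
  rewrite /ball/= ltr_norml; apply/andP; split; lra.
have J0 : mu (J (a, b)) = 0%E.
  apply/eqP; rewrite eq_le measure_ge0 andbT (le_trans _ U0)// le_measure// inE.
    exact: measurable_itv.
  exact: open_measurable.
have CE : C (pickle (a, b)) = J (a, b) by rewrite /C pickleK J0 eqxx.
exists (pickle (a, b)); [exact: I|rewrite CE].
by rewrite /J/= in_itv/= ax2 bx1.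
Qed.

Lemma carried_distribution (A : tracial_space R) (x : A) (mu : prob) :
  has_distribution x mu -> exists2 M, 0 < M & carried mu M.
Proof.
move=> [/compact_bounded[M [_ Mb]] _].
exists (`|M| + 1); first by rewrite ltr_wpDl.
apply: carried_msupport => t /(Mb (`|M| + 1) _) h.
by rewrite /= in_itv/= -ler_norml h// ltr_pwDr// ler_norm.
Qed.

End carried.

Section expect.
Context {R : realType}.
Variables (mu : probability (measurableTypeR R) R) (M : R).
Hypothesis muM : carried mu M.
Local Notation D := `[- M, M]%classic.

(** Integrating over the interval only lets bounds on it control the integral of
    functions, such as polynomials, that are unbounded on the line. *)
Definition expect (f : R -> R) : R := (\int[mu]_(t in D) f t)%R.

Definition admissible (f : R -> R) :=
  measurable_fun setT f /\ exists C, forall t, `|t| <= M -> `|f t| <= C.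

Let mD : measurable (D : set (measurableTypeR R)).
Proof. exact: measurable_itv. Qed.

Let inD t : D t <-> `|t| <= M.
Proof. by rewrite /= in_itv/= -ler_norml. Qed.

Let muD : mu D = 1%E.
Proof.
have := probability_setC mu (measurableC mD); rewrite setCK muM => ->.
by rewrite sube0.
Qed.

Lemma admissible_cst c : admissible (fun=> c).
Proof. by split; [exact: measurable_cst|exists `|c|]. Qed.

Lemma admissibleD f g :
  admissible f -> admissible g -> admissible (fun t => f t + g t).
Proof.
move=> [mf [C fC]] [mg [C' gC]]; split; first exact: measurable_funD.
by exists (C + C') => t tM; rewrite (le_trans (ler_normD _ _))// lerD ?fC ?gC.
Qed.

Lemma admissibleM f g :
  admissible f -> admissible g -> admissible (fun t => f t * g t).
Proof.
move=> [mf [C fC]] [mg [C' gC]]; split; first exact: measurable_funM.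
by exists (C * C') => t tM; rewrite normrM ler_pM ?fC ?gC.
Qed.

Lemma admissibleN f : admissible f -> admissible (fun t => - f t).
Proof.
move=> [mf [C fC]]; split; first exact: measurableT_comp.
by exists C => t tM; rewrite normrN fC.
Qed.

Lemma admissibleB f g :
  admissible f -> admissible g -> admissible (fun t => f t - g t).
Proof. by move=> af ag; apply: admissibleD => //; exact: admissibleN. Qed.

Lemma admissible_norm f : admissible f -> admissible (fun t => `|f t|).
Proof.
move=> [mf [C fC]]; split; first exact: measurableT_comp.
by exists C => t tM; rewrite normr_id fC.
Qed.

Lemma admissible_sum (I : Type) (s : seq I) (P : pred I) (f : I -> R -> R) :
  (forall i, admissible (f i)) -> admissible (fun t => \sum_(i <- s | P i) f i t).
Proof.
move=> af; elim: s => [|i s IH].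
  by under eq_fun do rewrite big_nil; exact: admissible_cst.
under eq_fun do rewrite big_cons; case: (P i) => //.
exact: admissibleD.
Qed.

Lemma admissible_continuous f : continuous f -> admissible f.
Proof.
move=> cf; split; first exact: continuous_measurable_fun.
have : bounded_set (f @` D).
  apply: compact_bounded; apply: continuous_compact.
    exact: continuous_subspaceT.
  exact: segment_compact.
move=> [N [_ Nb]]; exists (`|N| + 1) => t /inD tD.
apply: Nb; last by exists t.
by rewrite ltr_pwDr// ler_norm.
Qed.

Lemma admissible_horner (q : {poly R}) : admissible (fun t => q.[t]).
Proof. by apply: admissible_continuous; exact: continuous_horner. Qed.

Lemma admissible_indic y : admissible (fun t : R => (t <= y)%R%:R).
Proof.
split; last by exists 1 => t _; case: (t <= y); rewrite ?normr1 ?normr0.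
have -> : (fun t : R => (t <= y)%R%:R : R) =
    (\1_(`]-oo, y]%classic : set R) : R -> R).
  apply/funext => t; rewrite indicE; congr ((_ : bool)%:R).
  by apply/idP/idP; rewrite inE/= in_itv/=.
by apply: measurable_indic; exact: measurable_itv.
Qed.

Lemma admissible_integrable f : admissible f -> mu.-integrable D (EFin \o f).
Proof.
move=> [mf [C fC]]; apply: measurable_bounded_integrable => //.
- exact: (eq_ind_r (fun x => (x < +oo)%E) (ltry 1) muD).
- exact: measurable_funTS.
exists C; split; first exact: num_real.
move=> c Cc t /inD tD; exact: le_trans (fC _ tD) (ltW Cc).
Qed.

Lemma expect_cst c : expect (fun=> c) = c.
Proof. rewrite /expect Rintegral_cst// -[RHS]mulr1; congr (c * _).
have -> : 1 = fine (mu D) by rewrite muD.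
by [].
Qed.

Lemma expectD f g : admissible f -> admissible g ->
  expect (fun t => f t + g t) = expect f + expect g.
Proof. by move=> af ag; apply: RintegralD => //; exact: admissible_integrable. Qed.

Lemma expectZ c f : admissible f -> expect (fun t => c * f t) = c * expect f.
Proof. by move=> af; apply: RintegralZl => //; exact: admissible_integrable. Qed.

Lemma expectN f : admissible f -> expect (fun t => - f t) = - expect f.
Proof.
move=> af; rewrite -mulN1r -expectZ//.
by congr expect; apply/funext => t; rewrite mulN1r.
Qed.

Lemma expectB f g : admissible f -> admissible g ->
  expect (fun t => f t - g t) = expect f - expect g.
Proof. by move=> af ag; rewrite expectD ?expectN//; exact: admissibleN. Qed.

Lemma expect_sum (I : Type) (s : seq I) (P : pred I) (f : I -> R -> R) :
  (forall i, admissible (f i)) ->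
  expect (fun t => \sum_(i <- s | P i) f i t) = \sum_(i <- s | P i) expect (f i).
Proof.
move=> af; elim: s => [|i s IH].
  by rewrite big_nil; under eq_fun do rewrite big_nil; exact: expect_cst.
rewrite big_cons; under eq_fun do rewrite big_cons; case: (P i) => //.
by rewrite expectD ?IH//; exact: admissible_sum.
Qed.

Lemma expect_le f g : admissible f -> admissible g ->
  (forall t, `|t| <= M -> f t <= g t) -> expect f <= expect g.
Proof.
move=> af ag fg; apply: le_Rintegral => //; try exact: admissible_integrable.
by move=> t /inD; exact: fg.
Qed.

Lemma expect_norm_le f C : admissible f ->
  (forall t, `|t| <= M -> `|f t| <= C) -> `|expect f| <= C.
Proof.
move=> af fC; have aC := admissible_cst C; rewrite ler_norml.
have -> : - C = expect (fun=> - C) by rewrite expect_cst.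
have -> : expect f <= C = (expect f <= expect (fun=> C)) by rewrite expect_cst.
apply/andP; split; apply: expect_le => //; first exact: admissible_cst.
  by move=> t /fC; rewrite ler_norml => /andP[].
by move=> t /fC; rewrite ler_norml => /andP[].
Qed.

Lemma ler_norm_expect f : admissible f ->
  `|expect f| <= expect (fun t => `|f t|).
Proof. by move=> af; apply: le_normr_Rintegral => //; exact: admissible_integrable. Qed.

Lemma expect_norm_le_sqrt f c : 0 <= c -> admissible f ->
  expect (fun t => f t * f t) <= c ^+ 2 -> expect (fun t => `|f t|) <= c.
Proof.
move=> c0 af fc; set e := expect (fun t => `|f t|).
have an := admissible_norm af.
have e0 : 0 <= e.
  by rewrite -[0]expect_cst expect_le//; exact: admissible_cst.
have aff := admissibleM af af.
have aen := admissibleM (admissible_cst (2 * e)) an.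
have afe := admissibleB aff aen; have ae := admissible_cst (e * e).
have : 0 <= expect (fun t => (f t * f t - (2 * e) * `|f t|) + e * e).
  rewrite -[leLHS](expect_cst 0); apply: expect_le; first exact: admissible_cst.
    exact: admissibleD.
  move=> t _; rewrite -[f t * f t]ger0_norm -?expr2 ?sqr_ge0// normrX.
  by have := sqr_ge0 (`|f t| - e); rewrite !expr2; lra.
rewrite expectD// expect_cst expectB// expectZ//.
rewrite -/e => h; rewrite -(@ler_pXn2r _ 2)// ?nnegrE//.
by apply: le_trans fc; rewrite expr2; lra.
Qed.

Lemma expect_indic y : expect (fun t : R => (t <= y)%R%:R) = fine (mu `]-oo, y]%classic).
Proof.
have mI : measurable (`]-oo, y]%classic : set (measurableTypeR R)).
  exact: measurable_itv.
rewrite /expect /Rintegral; congr fine.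
transitivity (\int[mu]_(t in D) (\1_(`]-oo, y]%classic) t)%:E)%E.
  apply: eq_integral => t _; congr EFin; rewrite indicE; congr ((_ : bool)%:R).
  by apply/idP/idP; rewrite inE/= in_itv/=.
rewrite integral_indic//.
rewrite [RHS](measureDI mu mI mD) [X in _ = (X + _)%E](_ : _ = 0%E) ?add0e//.
apply/eqP; rewrite eq_le measure_ge0 andbT -muM le_measure ?inE//.
- exact: measurableD.
- exact: measurableC.
Qed.

Lemma expect_setT f : admissible f -> (\int[mu]_t f t)%R = expect f.
Proof.
move=> [mf [C fC]]; rewrite /expect /Rintegral [in RHS]integral_mkcond; congr fine.
apply: ae_eq_integral => //.
- exact: measurableT_comp.
- by apply/(measurable_restrictT _ _).1 => //; apply: measurable_funTS; exact: measurableT_comp.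
exists (~` D); split => //; first exact: measurableC.
move=> t /= tD tD'; apply: tD => _; rewrite patchE mem_set//.
Qed.

End expect.

(** * Approximate inversion of the K-transform *)

Section complex_numbers.
Context {R : rcfType}.
Implicit Types (x y g : R[i]) (a : R).

Lemma ImD x y : Im (x + y) = Im x + Im y. Proof. by case: x y => [? ?] []. Qed.
Lemma ImN x : Im (- x) = - Im x. Proof. by case: x. Qed.
Lemma ImB x y : Im (x - y) = Im x - Im y. Proof. by rewrite ImD ImN. Qed.
Lemma ReD x y : Re (x + y) = Re x + Re y. Proof. by case: x y => [? ?] []. Qed.
Lemma ReN x : Re (- x) = - Re x. Proof. by case: x. Qed.
Lemma ReB x y : Re (x - y) = Re x - Re y. Proof. by rewrite ReD ReN. Qed.

Lemma Im_sum n (F : 'I_n -> R[i]) : Im (\sum_(i < n) F i) = \sum_(i < n) Im (F i).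
Proof. by apply: (big_morph _ ImD). Qed.

Lemma ImZ a x : Im (a%:C * x) = a * Im x.
Proof. by case: x => u v /=; rewrite mul0r addr0. Qed.

Lemma Im_mulr x a : Im (x * a%:C) = Im x * a.
Proof. by rewrite mulrC ImZ mulrC. Qed.

Lemma cnorm_ge0 x : 0 <= cnorm x. Proof. by case: x => a b; rewrite /= sqrtr_ge0. Qed.

Lemma cnorm_real a : cnorm a%:C = `|a|.
Proof. by rewrite /cnorm /= expr0n addr0 sqrtr_sqr. Qed.

Lemma cnormM x y : cnorm (x * y) = cnorm x * cnorm y.
Proof. exact: ComplexField.Normc.normcM. Qed.

Lemma cnormV x : cnorm x^-1 = (cnorm x)^-1.
Proof. exact: ComplexField.Normc.normcV. Qed.

Lemma cnormX x n : cnorm (x ^+ n) = cnorm x ^+ n.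
Proof.
elim: n => [|n IH]; last by rewrite !exprS cnormM IH.
by rewrite !expr0 -[1]/(1%:C) cnorm_real normr1.
Qed.

Lemma ler_cnormD x y : cnorm (x + y) <= cnorm x + cnorm y.
Proof. exact: le_normcD. Qed.

Lemma cnormN x : cnorm (- x) = cnorm x.
Proof. by case: x => a b; rewrite /cnorm /= !sqrrN. Qed.

Lemma ler_cnormB x y : cnorm (x - y) <= cnorm x + cnorm y.
Proof. by rewrite -(cnormN y) ler_cnormD. Qed.

Lemma ler_cnorm_sum n (F : 'I_n -> R[i]) :
  cnorm (\sum_(i < n) F i) <= \sum_(i < n) cnorm (F i).
Proof.
elim: n F => [|n IH] F; first by rewrite !big_ord0 -[0]/(0%:C) cnorm_real normr0.
by rewrite !big_ord_recl (le_trans (ler_cnormD _ _))// lerD2l.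
Qed.

Lemma sqr_cnorm x : cnorm x ^+ 2 = Re x ^+ 2 + Im x ^+ 2.
Proof. by case: x => a b; rewrite /cnorm /= sqr_sqrtr// addr_ge0 ?sqr_ge0. Qed.

Lemma ler_Im_cnorm x : `|Im x| <= cnorm x.
Proof.
rewrite -(@ler_pXn2r _ 2)// ?nnegrE ?cnorm_ge0// sqr_cnorm real_normK ?num_real//.
by rewrite lerDr sqr_ge0.
Qed.

Lemma ler_Re_cnorm x : `|Re x| <= cnorm x.
Proof.
rewrite -(@ler_pXn2r _ 2)// ?nnegrE ?cnorm_ge0// sqr_cnorm real_normK ?num_real//.
by rewrite lerDl sqr_ge0.
Qed.

Lemma ler_Im_exp g n : cnorm g <= 1 -> `|Im (g ^+ n)| <= n%:R * `|Im g|.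
Proof.
move=> g1; elim: n => [|n IH]; first by rewrite expr0 /= normr0 mul0r.
have -> : Im (g ^+ n.+1) = Re g * Im (g ^+ n) + Im g * Re (g ^+ n).
  by rewrite exprS; case: (g ^+ n) => u v; case: (g) => u' v'.
rewrite (le_trans (ler_normD _ _))// !normrM -natr1 mulrDl mul1r lerD//.
  apply: le_trans IH; rewrite ler_piMl//.
  exact: le_trans (ler_Re_cnorm _) g1.
rewrite ler_piMr// (le_trans (ler_Re_cnorm _))// cnormX exprn_ile1//.
exact: cnorm_ge0.
Qed.

End complex_numbers.

Lemma sum_ord_top (V : nmodType) (f : nat -> V) m j :
  \sum_(a < m + j) f a = \sum_(a < m) f a + \sum_(a < j) f (m + j - a.+1)%N.
Proof.
elim: j => [|j IH]; first by rewrite addn0 big_ord0 addr0.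
rewrite addnS big_ord_recr/= IH [in RHS]big_ord_recl/= subSS subn0 -addrA.
by congr (_ + _); rewrite addrC.
Qed.

(** Truncation to N terms of the identity (1 + g R(g) - g t) P(g) = 1. *)
Lemma truncated_resolvent (F : comNzRingType) (t g : F) (r P : nat -> F) N :
  P 0%N = 1 ->
  (forall k, t * P k = P k.+1 + \sum_(j < k.+1) r j * P (k - j)%N) ->
  (1 + g * \sum_(j < N) r j * g ^+ j - g * t) * \sum_(k < N) g ^+ k * P k =
  1 - (g ^+ N * P N - g * \sum_(j < N) r j * g ^+ j *
    \sum_(a < j) g ^+ (N - a.+1) * P (N - a.+1)%N).
Proof.
move=> P0 PS.
have gts : g * t * \sum_(k < N) g ^+ k * P k =
    \sum_(k < N) g ^+ k * P k + g ^+ N * P N - 1 +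
    g * \sum_(j < N) r j * g ^+ j * (\sum_(k < N) g ^+ k * P k -
      \sum_(a < j) g ^+ (N - a.+1) * P (N - a.+1)%N).
  have -> : \sum_(k < N) g ^+ k * P k + g ^+ N * P N - 1 =
      \sum_(k < N) g ^+ k.+1 * P k.+1.
    rewrite -[X in X - 1](big_ord_recr N (fun k => g ^+ k * P k)).
    by rewrite big_ord_recl expr0 P0 mulr1 addrC addKr.
  case: N => [|n]; first by rewrite !big_ord0 !mulr0 addr0.
  have -> : \sum_(j < n.+1) r j * g ^+ j * (\sum_(k < n.+1) g ^+ k * P k -
      \sum_(a < j) g ^+ (n.+1 - a.+1) * P (n.+1 - a.+1)%N) =
      \sum_(l < n.+1) \sum_(j < l.+1) r j * g ^+ j * (g ^+ (l - j) * P (l - j)%N).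
    rewrite (triangle_sum n (fun j a _ => r j * g ^+ j * (g ^+ a * P a))).
    apply: eq_bigr => j _; rewrite -mulr_sumr; congr (_ * _).
    have jn : (j <= n)%N by rewrite -ltnS.
    have := sum_ord_top (fun a => g ^+ a * P a) (n - j).+1 j.
    by rewrite addSn subnK// => ->; rewrite addrK.
  rewrite !mulr_sumr -big_split/=; apply: eq_bigr => k _.
  rewrite mulrACA -exprS PS mulrDr; congr (_ + _).
  rewrite !mulr_sumr exprS; apply: eq_bigr => j _.
  have jk : (j <= k)%N by rewrite -ltnS.
  by rewrite -[in g ^+ k](subnKC jk) exprD; ring.
rewrite mulrBl gts mulrDl mul1r.
under [X in _ - (_ + g * X)]eq_bigr do rewrite mulrBr.
rewrite sumrB -mulr_suml; ring.
Qed.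

Section decay.
Context {R : realFieldType}.
Variables (r : nat -> R) (kappa : R).

(** Index 0 is the mean and index 1 the variance; the semicircle law is the case
    kappa = 0. *)
Definition near_semicircular := [/\ 0 <= kappa <= 1, r 0%N = 0, r 1%N = 1 &
  forall k, (1 < k)%N -> `|r k| <= kappa * 8^-1 ^+ k].

Lemma geometric_sum_le (q : R) n : 0 <= q < 1 -> \sum_(k < n) q ^+ k <= (1 - q)^-1.
Proof.
move=> /andP[q0 q1]; rewrite -[leRHS]mul1r ler_pdivlMr ?subr_gt0//.
have := subrX1 q n; have := exprn_ge0 n q0; set S := \sum_(k < n) _; lra.
Qed.

Lemma sum_delta_le n j : \sum_(k < n) ((k == j :> nat)%:R : R) <= 1.
Proof.
elim: n => [|n IH]; first by rewrite big_ord0.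
rewrite big_ord_recr/=; case: eqP => [->|_]; last by rewrite addr0.
rewrite big1 ?add0r// => i _; have := ltn_ord i.
by case: eqP => // ->; rewrite ltnn.
Qed.

Hypothesis nr : near_semicircular.

Lemma cumulant_double_sum_le k l :
  \sum_(c < k) \sum_(d < l) `|r (c + d).+1| <= (1 + kappa) ^+ 2.
Proof.
have [/andP[k0 k1] _ r1 rk] := nr.
have geo n : \sum_(c < n) (8^-1 : R) ^+ c <= 8 / 7.
  have := @geometric_sum_le (8^-1) n.
  have -> : (1 - 8^-1)^-1 = 8 / 7 :> R by field.
  by apply; lra.
have geo0 n : 0 <= \sum_(c < n) (8^-1 : R) ^+ c.
  by apply: sumr_ge0 => i _; rewrite exprn_ge0// invr_ge0.
have dl0 n : 0 <= \sum_(c < n) ((c == 0%N :> nat)%:R : R) by apply: sumr_ge0.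
apply: (@le_trans _ _ ((\sum_(c < k) (c == 0%N :> nat)%:R) *
    (\sum_(d < l) (d == 0%N :> nat)%:R) + kappa / 8 *
    ((\sum_(c < k) 8^-1 ^+ c) * (\sum_(d < l) 8^-1 ^+ d)))).
  rewrite !mulr_suml mulr_sumr -big_split/=; apply: ler_sum => c _.
  rewrite !mulr_sumr -big_split/=; apply: ler_sum => d _.
  have [/eqP cd|cd] := boolP ((c + d)%N == 0%N).
    have [-> ->] : nat_of_ord c = 0%N /\ nat_of_ord d = 0%N by lia.
    by rewrite /= addn0 r1 normr1 !expr0 !mulr1 lerDl divr_ge0.
  apply: (le_trans (rk _ _)); first by lia.
  rewrite exprS exprD -[leLHS]add0r; apply: lerD; first exact: mulr_ge0.
  by rewrite !mulrA.
have h1 := ler_pM (dl0 k) (dl0 l) (sum_delta_le k 0) (sum_delta_le l 0).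
have h2 := ler_pM (geo0 k) (geo0 l) (geo k) (geo l).
have h3 : kappa / 8 * ((\sum_(c < k) 8^-1 ^+ c) * (\sum_(d < l) 8^-1 ^+ d)) <=
    kappa / 8 * (8 / 7 * (8 / 7)) by rewrite ler_wpM2l// divr_ge0.
apply: le_trans (lerD h1 h3) _; rewrite expr2; nra.
Qed.

Lemma cumulant_moment_le n : \sum_(j < n | (1 < j)%N) j%:R * `|r j| <= kappa.
Proof.
have [/andP[k0 k1] _ _ rk] := nr.
apply: (@le_trans _ _ (\sum_(j < n) kappa / 2 * 4^-1 ^+ j)).
  rewrite big_mkcond/=; apply: ler_sum => j _; case: ifP => j1; last first.
    by rewrite mulr_ge0 ?divr_ge0// exprn_ge0// invr_ge0.
  apply: le_trans (ler_wpM2l _ (rk _ j1)) _ => //.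
  have -> : 8^-1 = 2^-1 * 4^-1 :> R by lra.
  have key : j%:R * 2^-1 ^+ j <= 2^-1 :> R.
    rewrite exprVn ler_pdivrMr ?exprn_gt0// ler_pdivlMl//.
    rewrite -natrX -natrM ler_nat; case: (nat_of_ord j) => // k.
    by rewrite expnS leq_mul2l/= ltn_expl.
  have q0 : 0 <= kappa * 4^-1 ^+ j by rewrite mulr_ge0// exprn_ge0.
  have -> : j%:R * (kappa * (2^-1 * 4^-1) ^+ j) =
      kappa * 4^-1 ^+ j * (j%:R * 2^-1 ^+ j) by rewrite exprMn; ring.
  have -> : kappa / 2 * 4^-1 ^+ j = kappa * 4^-1 ^+ j * 2^-1 by ring.
  by rewrite ler_wpM2l.
rewrite -mulr_sumr; have /= := @geometric_sum_le (4^-1) n.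
have -> : (1 - 4^-1)^-1 = 4 / 3 :> R by field.
set S := \sum_(j < n) _ => h; have {h} : S <= 4 / 3 by apply: h; lra.
nra.
Qed.

Lemma cumulant_sum_le n : \sum_(j < n | (1 < j)%N) `|r j| <= kappa.
Proof.
apply: le_trans (cumulant_moment_le n); apply: ler_sum => j j1.
by rewrite ler_peMl// ler1n ltnW.
Qed.

Lemma cumulant_full_moment_le n : \sum_(j < n) j%:R * `|r j| <= 1 + kappa.
Proof.
have [_ r0 r1 _] := nr; rewrite (bigID (fun j : 'I_n => (1 < j)%N))/= addrC.
apply: lerD (cumulant_moment_le n).
apply: le_trans (sum_delta_le n 1); rewrite big_mkcond/=; apply: ler_sum => -[j jn] _ /=.
by case: j jn => [|[|j]] jn /=; rewrite ?r0 ?r1 ?normr0 ?normr1 ?mulr0 ?mulr1.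
Qed.

End decay.

Section poly_expect.
Context {R : realType}.
Variables (mu : probability (measurableTypeR R) R) (M : R).

Definition poly_expect of carried mu M := fun q : {poly R} =>
  expect mu M (fun t => q.[t]).

Hypothesis muM : carried mu M.

Let poly_expect_linear : scalar (poly_expect muM).
Proof.
move=> a p q; rewrite /poly_expect.
have ap := admissible_horner M p; have aq := admissible_horner M q.
rewrite -expectZ// -expectD//; last first.
  by apply: admissibleM => //; exact: admissible_cst.
by congr expect; apply/funext => t; rewrite hornerD hornerZ.
Qed.

HB.instance Definition _ :=
  GRing.isLinear.Build R {poly R} R *%R (poly_expect muM) poly_expect_linear.

Lemma poly_expect1 : poly_expect muM 1 = 1.
Proof. by rewrite /poly_expect; under eq_fun do rewrite hornerC; exact: expect_cst. Qed.

End poly_expect.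

Section resolvent.
Context {R : realType}.
Variables (mu : probability (measurableTypeR R) R) (M : R).
Variables (r : nat -> R) (kappa : R).
Hypothesis muM : carried mu M.
Hypothesis nr : near_semicircular r kappa.
Hypothesis mu0 : forall k, poly_expect muM (cumulant_poly r k.+1) = 0.
Local Notation P k t := ((cumulant_poly r k).[t]).
Local Notation B := (1 + kappa).

Lemma expect_norm_cumulant_poly k :
  expect mu M (fun t => `|P k t|) <= B ^+ k.
Proof.
have [/andP[k0 k1] _ _ _] := nr.
apply: expect_norm_le_sqrt => //.
- by rewrite exprn_ge0// addr_ge0.
- exact: admissible_horner.
have b1 : 1 <= B by rewrite lerDl.
have := gram_le (poly_expect1 muM) mu0 b1 (cumulant_double_sum_le nr) k k.
rewrite -exprM mulnC mul2n -addnn; apply: le_trans.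
apply: le_trans (ler_norm _); rewrite /poly_expect le_eqVlt; apply/orP; left.
by apply/eqP; congr expect; apply/funext => t; rewrite hornerM.
Qed.

Definition ktransform N (g : R[i]) : R[i] :=
  g^-1 + \sum_(j < N) (r j)%:C * g ^+ j.

(** Dominates the error in the truncated inversion, divided by |g| ^ N. *)
Definition remainder_weight N t : R := `|P N t| +
  \sum_(j < N) `|r j| * \sum_(a < j) `|P (N - a.+1)%N t|.

Lemma admissible_remainder_weight N : admissible M (remainder_weight N).
Proof.
have aP k : admissible M (fun t => `|P k t|).
  by apply: admissible_norm; exact: admissible_horner.
apply: admissibleD => //; apply: admissible_sum => j.
by apply: admissibleM; [exact: admissible_cst|exact: admissible_sum].
Qed.

Lemma expect_remainder_weight N : expect mu M (remainder_weight N) <= 3 * B ^+ N.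
Proof.
have [/andP[k0 k1] _ _ _] := nr.
have b1 : 1 <= B by rewrite lerDl.
have aP k : admissible M (fun t => `|P k t|).
  by apply: admissible_norm; exact: admissible_horner.
have aS (j : 'I_N) : admissible M (fun t => \sum_(a < j) `|P (N - a.+1)%N t|).
  exact: admissible_sum.
have aT (j : 'I_N) : admissible M
    (fun t => `|r j| * \sum_(a < j) `|P (N - a.+1)%N t|).
  by apply: admissibleM => //; exact: admissible_cst.
rewrite /remainder_weight expectD//; last exact: admissible_sum.
rewrite expect_sum//.
apply: (@le_trans _ _ (B ^+ N + \sum_(j < N) j%:R * `|r j| * B ^+ N)).
  apply: lerD; first exact: expect_norm_cumulant_poly.
  apply: ler_sum => j _; rewrite expectZ// expect_sum// [_%:R * _]mulrC -mulrA ler_wpM2l//.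
  apply: (@le_trans _ _ (\sum_(a < j) B ^+ N)); last first.
    by rewrite sumr_const card_ord mulr_natl.
  apply: ler_sum => a _; apply: le_trans (expect_norm_cumulant_poly _) _.
  by apply: ler_weXn2l => //; exact: leq_subr.
rewrite -mulr_suml; have := cumulant_full_moment_le nr N.
have BN : 0 <= B ^+ N by rewrite exprn_ge0// addr_ge0.
set S := \sum_(j < N) _ => SB; have : S * B ^+ N <= 2 * B ^+ N.
  by rewrite ler_wpM2r//; apply: le_trans SB _; lra.
lra.
Qed.

Definition truncated_series N (g : R[i]) t : R[i] :=
  \sum_(k < N) g ^+ k * (P k t)%:C.

Let remainder N (g : R[i]) t : R[i] := g ^+ N * (P N t)%:C -
  g * \sum_(j < N) (r j)%:C * g ^+ j *
    \sum_(a < j) g ^+ (N - a.+1) * (P (N - a.+1)%N t)%:C.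

Let truncated_seriesE N (g : R[i]) t : g != 0 ->
  g * (ktransform N g - t%:C) * truncated_series N g t = 1 - remainder N g t.
Proof.
move=> g0.
rewrite -(@truncated_resolvent _ t%:C g (fun j => (r j)%:C) (fun k => (P k t)%:C)).
- by congr (_ * _); rewrite /ktransform mulrBr mulrDr divff.
- by rewrite cumulant_poly0 hornerC.
move=> k; rewrite -rmorphM/=.
have := congr1 (fun q : {poly R} => q.[t]) (mulX_cumulant_poly r k).
rewrite hornerM hornerX => ->; rewrite hornerD rmorphD horner_sum rmorph_sum/=.
by congr (_ + _); apply: eq_bigr => j _; rewrite hornerZ rmorphM.
Qed.

Let remainder_le N g t : cnorm g <= 1 ->
  cnorm (remainder N g t) <= cnorm g ^+ N * remainder_weight N t.
Proof.
move=> g1; have g0 := cnorm_ge0 g.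
rewrite (le_trans (ler_cnormB _ _))// /remainder_weight mulrDr.
rewrite [X in X + _]cnormM cnormX cnorm_real lerD2l cnormM.
apply: le_trans (ler_wpM2l g0 (ler_cnorm_sum _)) _.
rewrite !mulr_sumr; apply: ler_sum => j _.
rewrite !cnormM cnorm_real cnormX [leRHS]mulrCA.
set S := \sum_(a < j) (_ * _); set S' := \sum_(a < j) _.
have -> : cnorm g * (`|r j| * cnorm g ^+ j * cnorm S) =
    `|r j| * (cnorm g ^+ j.+1 * cnorm S) by rewrite exprS; ring.
apply: ler_wpM2l => //.
apply: le_trans (ler_wpM2l (exprn_ge0 _ g0) (ler_cnorm_sum _)) _.
rewrite !mulr_sumr; apply: ler_sum => a _.
rewrite cnormM cnormX cnorm_real mulrA -exprD; apply: ler_wpM2r => //.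
by have := ltn_ord a; have := ltn_ord j => jN aj; apply: ler_wiXn2l => //; lia.
Qed.

Let expect_truncated_series N (g D : R[i]) : (0 < N)%N ->
  expect mu M (fun t => Im (D * (g * truncated_series N g t))) = Im (D * g).
Proof.
case: N => // N _.
have -> : (fun t => Im (D * (g * truncated_series N.+1 g t))) =
    (fun t => \sum_(k < N.+1) Im (D * (g * g ^+ k)) * P k t).
  apply/funext => t; rewrite /truncated_series !mulr_sumr Im_sum.
  by apply: eq_bigr => k _; rewrite !mulrA Im_mulr.
have aP k : admissible M (fun t => P k t) by exact: admissible_horner.
rewrite expect_sum//; last first.
  by move=> k; apply: admissibleM => //; exact: admissible_cst.
rewrite big_ord_recl/= big1 => [|k _]; last first.
  by rewrite expectZ//; have := mu0 k; rewrite /poly_expect /bump/= => ->; rewrite mulr0.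
by rewrite expectZ//; have := poly_expect1 muM; rewrite /poly_expect cumulant_poly0 => ->;
  rewrite mulr1 addr0 expr0 mulr1.
Qed.

Lemma admissible_resolvent (D z : R[i]) : Im z != 0 ->
  admissible M (fun t => Im (D / (z - t%:C))).
Proof.
case: D z => [dx dy] [x y]/= y0; apply: admissible_continuous.
pose p1 : {poly R} := (dy * x - dx * y)%:P - dy *: 'X.
pose p2 : {poly R} := (x%:P - 'X) ^+ 2 + (y ^+ 2)%:P.
have E2 t : p2.[t] = (x - t) ^+ 2 + y ^+ 2 by rewrite /p2 !hornerE.
have -> : (fun t : R => Im ((dx +i* dy) / ((x +i* y) - t%:C))) =
    (fun t => p1.[t] * (p2.[t])^-1).
  by apply/funext => t; rewrite E2 /p1 !hornerE /= subr0; ring.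
move=> t; apply: cvgM; first exact: continuous_horner.
apply: cvgV; last exact: continuous_horner.
by rewrite E2 gt_eqF// ltr_wpDl ?sqr_ge0// exprn_even_gt0.
Qed.

(** The truncated series is the resolvent up to a remainder whose mean modulus
    is of order (|g| (1 + kappa)) ^ N by the bound on the Gram matrix. So the
    Cauchy transform of mu at the point K(g) is g, for all g of modulus less than
    1 / (1 + kappa) at which K(g) is not real. *)
Lemma expect_resolvent N (g D : R[i]) : (0 < N)%N -> g != 0 -> cnorm g <= 1 ->
  0 < Im (ktransform N g) ->
  `|expect mu M (fun t => Im (D / (ktransform N g - t%:C))) - Im (D * g)| <=
  cnorm D * (3 * (cnorm g * B) ^+ N) / Im (ktransform N g).
Proof.
move=> N0 g0 g1; set z := ktransform N g => y0.
have zt t : z - t%:C != 0.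
  apply/eqP => /(congr1 (fun x => Im x)); rewrite ImB /= subr0 => h.
  by rewrite h ltxx in y0.
have ar := @admissible_resolvent D z (lt0r_neq0 y0).
have ah : admissible M (fun t => Im (D * (g * truncated_series N g t))).
  have -> : (fun t => Im (D * (g * truncated_series N g t))) =
      (fun t => \sum_(k < N) Im (D * (g * g ^+ k)) * P k t).
    apply/funext => t; rewrite /truncated_series !mulr_sumr Im_sum.
    by apply: eq_bigr => k _; rewrite !mulrA Im_mulr.
  apply: admissible_sum => k; apply: admissibleM; first exact: admissible_cst.
  exact: admissible_horner.
rewrite -(expect_truncated_series g D N0) -expectB//.
have afh := admissibleB ar ah; have aw := admissible_remainder_weight N.
apply: le_trans (ler_norm_expect muM afh) _.
set c := cnorm D * cnorm g ^+ N / Im z.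
have c0 : 0 <= c.
  by rewrite divr_ge0 ?(ltW y0)// mulr_ge0 ?cnorm_ge0// exprn_ge0// cnorm_ge0.
apply: (@le_trans _ _ (expect mu M (fun t => c * remainder_weight N t))).
  apply: expect_le => //; first exact: admissible_norm.
    by apply: admissibleM => //; exact: admissible_cst.
  move=> t _; rewrite -ImB; apply: le_trans (ler_Im_cnorm _) _.
  have -> : D / (z - t%:C) - D * (g * truncated_series N g t) =
      D * (remainder N g t / (z - t%:C)).
    have := truncated_seriesE N t g0; rewrite -/z => h.
    have -> : remainder N g t = 1 - g * (z - t%:C) * truncated_series N g t.
      by rewrite h; ring.
    by field; exact: zt.
  rewrite !cnormM cnormV /c -!mulrA ler_wpM2l ?cnorm_ge0//.
  have w0 : 0 <= cnorm g ^+ N * remainder_weight N t.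
    by apply: le_trans (remainder_le N t g1); exact: cnorm_ge0.
  rewrite mulrCA mulrC; apply: ler_pM (remainder_le N t g1).
  - by rewrite invr_ge0 cnorm_ge0.
  - exact: cnorm_ge0.
  rewrite lef_pV2 ?posrE//; last first.
    by rewrite (lt_le_trans y0)// (le_trans (ler_norm _))// -[z in Im z](subrK t%:C)
      ImD addr0 ler_Im_cnorm.
  rewrite (le_trans (ler_norm _))// -[z in Im z](subrK t%:C) ImD addr0.
  exact: ler_Im_cnorm.
rewrite expectZ//; apply: le_trans (ler_wpM2l c0 (expect_remainder_weight N)) _.
by rewrite /c exprMn le_eqVlt; apply/orP; left; apply/eqP; ring.
Qed.

End resolvent.

(** * The logarithmic potential along rays *)

Section arctangent.
Context {R : realType}.
Implicit Types (z D : R[i]) (v s : R).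

(** Up to sign and the constant pi / 2, the argument of a point of the upper
    half-plane. *)
Definition argument z : R := atan (Re z / Im z).

Lemma Im_div D z :
  Im (D / z) = (Im D * Re z - Re D * Im z) / (Re z ^+ 2 + Im z ^+ 2).
Proof. by case: D z => [a b] [x y] /=; ring. Qed.

Let is_derive_argument z D s : 0 < Im z + s * Im D ->
  is_derive s 1 (fun s => argument (z + s%:C * D)) (- Im (D / (z + s%:C * D))).
Proof.
move=> y0.
have -> : (fun s => argument (z + s%:C * D)) =
    atan \o (fun s => (Re z + s * Re D) / (Im z + s * Im D)).
  apply/funext => u; rewrite /argument /= ImD ImZ ReD; congr (atan ((_ + _) / _)).
  by case: (D) => ? ? /=; rewrite mul0r subr0.
apply: is_derive_eq; first by apply: is_derive1_comp; apply: is_deriveM;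
  apply: is_deriveV; exact: lt0r_neq0.
rewrite /GRing.scale /= Im_div ImD ImZ.
have -> : Re (z + s%:C * D) = Re z + s * Re D.
  by rewrite ReD; case: (D) => ? ? /=; rewrite mul0r subr0.
move: y0; set y := Im z + s * Im D; set x := Re z + s * Re D => y0.
have q0 : x ^+ 2 + y ^+ 2 != 0 by rewrite gt_eqF// ltr_wpDl ?sqr_ge0// exprn_gt0.
by field; rewrite q0 lt0r_neq0.
Qed.

Let segment_ge z z' v s : v <= Im z -> v <= Im z' -> 0 <= s <= 1 ->
  v <= Im (z + s%:C * (z' - z)).
Proof.
move=> vz vz' /andP[s0 s1]; rewrite ImD ImZ ImB.
have := ler_wpM2l s0 vz'; have := @ler_wpM2l _ (1 - s) _ _ _ vz.
by rewrite subr_ge0 => /(_ s1); lra.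
Qed.

Let argument_MVT z z' v : 0 < v -> v <= Im z -> v <= Im z' ->
  exists2 c, 0 <= c <= 1 & argument z' - argument z =
    - Im ((z' - z) / (z + c%:C * (z' - z))).
Proof.
move=> v0 vz vz'; set D := z' - z.
have dA s : 0 <= s <= 1 -> is_derive s 1 (fun s => argument (z + s%:C * D))
    (- Im (D / (z + s%:C * D))).
  move=> s01; apply: is_derive_argument; apply: lt_le_trans v0 _.
  by rewrite -ImZ -ImD; exact: segment_ge.
pose phi s := argument (z + s%:C * D).
have dphi s : s \in `]0, 1[%R -> is_derive s 1 phi (- Im (D / (z + s%:C * D))).
  by rewrite in_itv/= => /andP[s0 s1]; apply: dA; rewrite !ltW.
have cphi : {within `[0, 1], continuous phi}.
  apply: derivable_within_continuous => s; rewrite in_itv/= => s01.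
  by have := dA s s01 => -[].
have [c] := MVT ltr01 dphi cphi.
rewrite in_itv/= => /andP[c0 c1] E; exists c; first by rewrite !ltW.
by move: E; rewrite /phi mul0r addr0 mul1r subr0 mulr1 /D [z + _]addrC subrK => <-.
Qed.

Lemma argument_lipschitz z z' v : 0 < v -> v <= Im z -> v <= Im z' ->
  `|argument z' - argument z| <= cnorm (z' - z) / v.
Proof.
move=> v0 vz vz'; have [c c01 ->] := argument_MVT v0 vz vz'.
rewrite normrN (le_trans (ler_Im_cnorm _))// cnormM cnormV ler_wpM2l ?cnorm_ge0//.
have h : v <= cnorm (z + c%:C * (z' - z)).
  apply: le_trans (segment_ge vz vz' c01) _.
  by rewrite (le_trans (ler_norm _))// ler_Im_cnorm.
by rewrite lef_pV2 ?posrE//; exact: lt_le_trans h.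
Qed.

(** The differential of the argument is - Im (dz / z), and 1 / z is Lipschitz with
    constant 1 / v ^ 2 on the half-plane Im z >= v. *)
Lemma argument_increment z z' v : 0 < v -> v <= Im z -> v <= Im z' ->
  `|argument z' - argument z + Im ((z' - z) / z)| <= cnorm (z' - z) ^+ 2 / v ^+ 2.
Proof.
move=> v0 vz vz'; have [c c01 ->] := argument_MVT v0 vz vz'.
set D := z' - z; set w := z + c%:C * D.
have hw : v <= cnorm w.
  apply: le_trans (segment_ge vz vz' c01) _.
  by rewrite (le_trans (ler_norm _))// ler_Im_cnorm.
have hz : v <= cnorm z by rewrite (le_trans vz)// (le_trans (ler_norm _))// ler_Im_cnorm.
have cn0 x : v <= cnorm x -> x != 0.
  move=> vx; apply/eqP => x0; move: (lt_le_trans v0 vx).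
  by rewrite x0 ComplexField.Normc.normc0 ltxx.
have -> : - Im (D / w) + Im (D / z) = Im (c%:C * (D * D / (w * z))).
  rewrite -ImN -ImD; congr (Im _).
  by rewrite /w; field; rewrite (cn0 _ hz) (cn0 _ hw).
rewrite (le_trans (ler_Im_cnorm _))// !cnormM cnorm_real cnormV cnormM.
have /andP[c0 c1] := c01.
rewrite ger0_norm//; apply: le_trans (ler_piMl _ c1) _.
  by rewrite mulr_ge0 ?mulr_ge0 ?cnorm_ge0// invr_ge0 mulr_ge0 ?cnorm_ge0.
rewrite -expr2 ler_wpM2l ?sqr_ge0// lef_pV2 ?posrE ?exprn_gt0//.
  by rewrite expr2; apply: ler_pM => //; exact: ltW.
by rewrite mulr_gt0 ?(lt_le_trans v0 hw) ?(lt_le_trans v0 hz).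
Qed.

End arctangent.

(** Over n equal steps the quadratic terms add up to O(1 / n). *)
Lemma subdivision_le (R : archiRealFieldType) (f : R -> R) (a b A C : R) :
  a <= b ->
  (forall s s', a <= s <= b -> a <= s' <= b -> s <= s' ->
    `|f s' - f s| <= A * (s' - s) + C * (s' - s) ^+ 2) ->
  `|f b - f a| <= A * (b - a).
Proof.
move=> ab fle; apply/ler_addgt0Pr => e e0.
have [C0|C0] := leP C 0.
  apply: le_trans (fle a b _ _ ab) _; rewrite ?lexx ?ab//.
  by rewrite lerD2l (le_trans _ (ltW e0))// mulr_le0_ge0// sqr_ge0.
set K := C * (b - a) ^+ 2.
pose n := (Num.truncn (K / e)).+1.
have n0 : (0 : R) < n%:R by rewrite ltr0n.
have nK : K / n%:R <= e.
  by rewrite ler_pdivrMr// -ler_pdivrMl// mulrC; apply/ltW/truncnS_gt.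
pose h := (b - a) / n%:R; pose x k := a + k%:R * h.
have h0 : 0 <= h by rewrite divr_ge0 ?subr_ge0// ltW.
have xn : x n = b by rewrite /x /h mulrCA divff ?gt_eqF// mulr1 addrC subrK.
have x0 : x 0%N = a by rewrite /x mul0r addr0.
have xin k : (k <= n)%N -> a <= x k <= b.
  move=> kn; rewrite lerDl mulr_ge0// -xn lerD2l ler_wpM2r// ler_nat.
  by [].
have step k : (k < n)%N -> `|f (x k.+1) - f (x k)| <= A * h + C * h ^+ 2.
  move=> kn; have xS : x k.+1 - x k = h by rewrite /x -natr1; ring.
  by rewrite -xS; apply: fle; [exact/xin/ltnW|exact: xin|rewrite -subr_ge0 xS].
have tel k : (k <= n)%N -> `|f (x k) - f a| <= k%:R * (A * h + C * h ^+ 2).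
  elim: k => [|k IH] kn; first by rewrite x0 subrr normr0 mul0r.
  rewrite -(subrK (f (x k)) (f (x k.+1))) -addrA (le_trans (ler_normD _ _))//.
  by rewrite -natr1 mulrDl mul1r [leLHS]addrC lerD ?IH ?step ?(ltnW kn).
have := tel n (leqnn n); rewrite xn => /le_trans; apply.
rewrite mulrDr; have -> : n%:R * (A * h) = A * (b - a).
  by rewrite /h; field; rewrite gt_eqF.
rewrite lerD2l; have -> : n%:R * (C * h ^+ 2) = K / n%:R.
  by rewrite /h /K; field; rewrite gt_eqF.
exact: nK.
Qed.

Lemma power_increment_le (R : realDomainType) (s s' : R) j :
  0 <= s -> s <= s' -> s' <= 1 -> `|s' ^+ j - s ^+ j| <= j%:R * (s' - s).
Proof.
move=> s0 ss' s1; elim: j => [|j IH]; first by rewrite subrr normr0 mul0r.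
have -> : s' ^+ j.+1 - s ^+ j.+1 = s' * (s' ^+ j - s ^+ j) + s ^+ j * (s' - s).
  by rewrite !exprS; ring.
rewrite (le_trans (ler_normD _ _))// -natr1 mulrDl mul1r !normrM.
have s'0 : 0 <= s' by exact: le_trans ss'.
apply: lerD.
  by apply: le_trans IH; rewrite ler_piMl// ger0_norm.
rewrite [X in _ * X]ger0_norm ?subr_ge0// ler_piMl ?subr_ge0//.
by rewrite ger0_norm ?exprn_ge0// exprn_ile1// (le_trans ss').
Qed.

(** The two terms on the left have the same derivative in s' at s' = s, which is
    j (s ^ j). *)
Lemma power_primitive_le (R : realFieldType) (s s' : R) j :
  0 <= s -> s <= s' -> s' <= 1 ->
  `|s * (s' ^+ j - s ^+ j) - j%:R / j.+1%:R * (s' ^+ j.+1 - s ^+ j.+1)| <=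
  j%:R * (s' - s) ^+ 2.
Proof.
move=> s0 ss' s1; have s'0 : 0 <= s' by exact: le_trans ss'.
pose W k := k%:R * s' ^+ k.+1 - k.+1%:R * s * s' ^+ k + s ^+ k.+1.
have WS k : W k.+1 = s' * W k + (s' - s) * (s' ^+ k.+1 - s ^+ k.+1).
  by rewrite /W -!natr1 !exprS; ring.
have Wle k : `|W k| <= k%:R * k.+1%:R * (s' - s) ^+ 2.
  elim: k => [|k IH]; first by rewrite /W !mul0r expr0 expr1 mulr1 mul1r add0r addNr normr0.
  rewrite WS (le_trans (ler_normD _ _))// !normrM.
  have h1 : `|s'| * `|W k| <= k%:R * k.+1%:R * (s' - s) ^+ 2.
    by apply: le_trans IH; rewrite ler_piMl// ger0_norm.
  have h2 : `|s' - s| * `|s' ^+ k.+1 - s ^+ k.+1| <= k.+1%:R * (s' - s) ^+ 2.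
    rewrite ger0_norm ?subr_ge0// expr2 mulrCA ler_wpM2l ?subr_ge0//.
    exact: power_increment_le.
  apply: le_trans (lerD h1 h2) _; rewrite -mulrDl ler_wpM2r ?sqr_ge0//.
  by rewrite -!natr1; have := ler0n R k; nra.
have -> : s * (s' ^+ j - s ^+ j) - j%:R / j.+1%:R * (s' ^+ j.+1 - s ^+ j.+1) =
    - (W j / j.+1%:R).
  by rewrite /W !exprS -natr1; field; rewrite natr1 pnatr_eq0.
rewrite normrN normrM normfV [`|j.+1%:R|]ger0_norm// ler_pdivrMr//.
by rewrite mulrAC Wle.
Qed.

Lemma geometric_eventually_le (R : realType) (q e : R) : 0 <= q < 1 -> 0 < e ->
  exists N0, forall N, (N0 <= N)%N -> q ^+ N <= e.
Proof.
move=> /andP[q0 q1] e0.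
have : `|q| < 1 by rewrite ger0_norm.
move=> /cvg_expr/cvgrPdist_le/(_ e e0)[N0 _ hN]; exists N0 => N /hN.
by rewrite /= sub0r normrN ger0_norm// exprn_ge0.
Qed.

Lemma ler_norm_chain (R : numDomainType) (p e i q X Y Z : R) :
  `|p + e| <= X -> `|e - i| <= Y -> `|i - q| <= Z -> `|p + q| <= X + Y + Z.
Proof.
move=> hX hY hZ; have -> : p + q = p + e - (e - i) - (i - q) by ring.
apply: le_trans (ler_normB _ _) (lerD _ hZ).
exact: le_trans (ler_normB _ _) (lerD hX hY).
Qed.

Section potential.
Context {R : realType}.
Variables (mu : probability (measurableTypeR R) R) (M : R).
Implicit Types (z D g : R[i]).

(** The imaginary part of the integral of log (z - t), up to sign and a
    constant. *)
Definition potential z : R := expect mu M (fun t => argument (z - t%:C)).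

Hypothesis muM : carried mu M.

Lemma admissible_argument z : admissible M (fun t => argument (z - t%:C)).
Proof.
apply: admissible_continuous.
have -> : (fun t : R => argument (z - t%:C)) =
    atan \o (fun t => ((Im z)^-1 *: ((Re z)%:P - 'X) : {poly R}).[t]).
  by apply/funext => t; rewrite /argument /= !hornerE ReB ImB/= subr0 mulrC.
move=> t; apply: continuous_comp; first exact: continuous_horner.
exact: continuous_atan.
Qed.

Lemma potential_increment z z' v : 0 < v -> v <= Im z -> v <= Im z' ->
  `|potential z' - potential z +
    expect mu M (fun t => Im ((z' - z) / (z - t%:C)))| <=
  cnorm (z' - z) ^+ 2 / v ^+ 2.
Proof.
move=> v0 vz vz'; have az := admissible_argument z.
have az' := admissible_argument z'.
have y0 : Im z != 0 by rewrite lt0r_neq0// (lt_le_trans v0).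
have ar := @admissible_resolvent _ M (z' - z) z y0.
have ad := admissibleB az' az.
rewrite -expectB// -expectD//; apply: expect_norm_le => //.
  exact: admissibleD.
move=> t _; have := @argument_increment _ (z - t%:C) (z' - t%:C) v v0.
rewrite !ImB/= !subr0 => /(_ vz vz').
by have -> : z' - t%:C - (z - t%:C) = z' - z by ring.
Qed.

Variables (r : nat -> R) (kappa : R).
Hypothesis nr : near_semicircular r kappa.
Hypothesis mu0 : forall k, poly_expect muM (cumulant_poly r k.+1) = 0.
Local Notation B := (1 + kappa).
Local Notation K := (ktransform r).

(** The terms of index less than N of the primitive of g R'(g) with value 0
    at 0. *)
Definition log_correction N g : R[i] :=
  \sum_(j < N) (r j * (j%:R / j.+1%:R))%:C * g ^+ j.+1.

Lemma Im_inv g : Im g^-1 = - Im g / cnorm g ^+ 2.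
Proof. by rewrite sqr_cnorm; case: g => x y /=; ring. Qed.

Section radial_path.
Variable g : R[i].
Hypothesis g0 : Im g < 0.
Hypothesis gB : B * cnorm g < 1.
Local Notation rho := (cnorm g).
Local Notation v1 := (- Im g * (rho ^- 2 - B)).

Let k01 : 0 <= kappa <= 1. Proof. by have [] := nr. Qed.

Let rho0 : 0 < rho.
Proof. by apply: lt_le_trans (ler_Im_cnorm g); rewrite normr_gt0 lt_eqF. Qed.

Let rho1 : rho <= 1.
Proof. by have := gB; have := rho0; have /andP[] := k01; nra. Qed.

Let rhoB : B * rho ^+ 2 < 1.
Proof. by have := gB; have := rho1; have := rho0; have /andP[] := k01; nra. Qed.

Let gn0 : g != 0.
Proof. by apply/eqP => gz; have := g0; rewrite gz ltxx. Qed.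

Let v1_gt0 : 0 < v1.
Proof.
rewrite mulr_gt0 ?oppr_gt0// subr_gt0 -[rho ^- 2]mul1r.
by rewrite ltr_pdivlMr ?exprn_gt0.
Qed.

Let cnorm_ray s : 0 <= s -> cnorm (s%:C * g) = s * rho.
Proof. by move=> s0; rewrite cnormM cnorm_real ger0_norm. Qed.

Let ray_le1 s : 0 <= s <= 1 -> cnorm (s%:C * g) <= rho.
Proof. by move=> /andP[s0 s1]; rewrite cnorm_ray// ler_piMl// ltW. Qed.

(** In the unit disc |Im (g ^ j)| <= j |Im g|, so the power series part of the
    K-transform cannot outweigh the imaginary part of 1 / g. *)
Lemma Im_ktransform_ge s N : 0 < s <= 1 -> v1 / s <= Im (K N (s%:C * g)).
Proof.
move=> /andP[s0 s1]; rewrite /ktransform ImD.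
have -> : Im (s%:C * g)^-1 = - Im g / (s * rho ^+ 2).
  rewrite Im_inv ImZ cnorm_ray ?ltW//.
  by field; rewrite !lt0r_neq0.
rewrite Im_sum; set S := \sum_(j < N) _.
have : `|S| <= B * (s * - Im g).
  rewrite (le_trans (ler_norm_sum _ _ _))//.
  apply: le_trans (ler_wpM2r _ (cumulant_full_moment_le nr N)); last first.
    by rewrite mulr_ge0 ?ltW// oppr_gt0.
  rewrite mulr_suml; apply: ler_sum => j _; rewrite ImZ normrM [X in _ <= X * _]mulrC -mulrA.
  apply: ler_wpM2l => //; apply: le_trans (ler_Im_exp _ _) _.
    by apply: le_trans rho1; apply: ray_le1; rewrite ltW.
  by rewrite ImZ normrM [`|s|]gtr0_norm// ltr0_norm.
rewrite ler_norml => /andP[+ _].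
have -> : - Im g / (s * rho ^+ 2) = - Im g * rho ^- 2 / s.
  by field; rewrite !lt0r_neq0.
have -> : v1 / s = - Im g * rho ^- 2 / s - (- Im g) * B / s by ring.
have : (- Im g) * B * s <= (- Im g) * B / s.
  rewrite ler_wpM2l//; last first.
    by rewrite (@le_trans _ _ 1)// invf_ge1.
  by rewrite mulr_ge0 ?oppr_ge0 ?(ltW g0)// addr_ge0//; have /andP[] := k01.
lra.
Qed.

Let ktransform_rayB s s' N : K N (s'%:C * g) - K N (s%:C * g) =
  (s'^-1 - s^-1)%:C * g^-1 + \sum_(j < N) (r j * (s' ^+ j - s ^+ j))%:C * g ^+ j.
Proof.
rewrite /ktransform !invfM -!(fmorphV (real_complex R)) rmorphB/= mulrBl.
rewrite opprD addrACA -sumrB; congr (_ + _); apply: eq_bigr => j _.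
by rewrite !exprMn rmorphM rmorphB !rmorphXn/=; ring.
Qed.

Let ktransform_lipschitz s0 s s' N : 0 < s0 -> s0 <= s -> s <= s' -> s' <= 1 ->
  cnorm (K N (s'%:C * g) - K N (s%:C * g)) <= (s0 ^- 2 / rho + B) * (s' - s).
Proof.
move=> s00 ss ss' s1; rewrite ktransform_rayB (le_trans (ler_cnormD _ _))//.
have s_gt0 : 0 < s by exact: lt_le_trans ss.
have s'_gt0 : 0 < s' by exact: lt_le_trans ss'.
have h0 : 0 <= s' - s by rewrite subr_ge0.
rewrite mulrDl lerD//.
  rewrite cnormM cnorm_real cnormV mulrAC; apply: ler_wpM2r; first by rewrite invr_ge0 ltW.
  have -> : s'^-1 - s^-1 = - ((s' * s)^-1 * (s' - s)).
    by field; rewrite !lt0r_neq0.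
  rewrite normrN normrM [`|s' - s|]ger0_norm//; apply: ler_wpM2r => //.
  have -> : `|(s' * s)^-1| = (s' * s)^-1.
    by rewrite ger0_norm// invr_ge0 mulr_ge0// ltW.
  rewrite lef_pV2 ?posrE ?exprn_gt0 ?mulr_gt0//.
  by rewrite expr2; apply: ler_pM; rewrite ?(ltW s00)//; exact: le_trans ss'.
rewrite (le_trans (ler_cnorm_sum _))//.
apply: le_trans (ler_wpM2r h0 (cumulant_full_moment_le nr N)).
rewrite mulr_suml; apply: ler_sum => j _.
rewrite cnormM cnorm_real normrM cnormX [X in _ <= X * _]mulrC -!mulrA.
apply: ler_wpM2l => //; rewrite -[leRHS]mulr1; apply: ler_pM => //.
- by rewrite exprn_ge0// ltW.
- by apply: power_increment_le => //; exact: ltW.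
- by rewrite exprn_ile1// ltW.
Qed.

Let log_correction_increment s s' N : 0 < s -> s <= s' -> s' <= 1 ->
  `|Im ((K N (s'%:C * g) - K N (s%:C * g)) * (s%:C * g)) -
    Im (log_correction N (s'%:C * g) - log_correction N (s%:C * g))| <=
  B * (s' - s) ^+ 2.
Proof.
move=> s_gt0 ss' s1; rewrite ktransform_rayB -ImB.
have -> : ((s'^-1 - s^-1)%:C * g^-1 +
    \sum_(j < N) (r j * (s' ^+ j - s ^+ j))%:C * g ^+ j) * (s%:C * g) -
    (log_correction N (s'%:C * g) - log_correction N (s%:C * g)) =
    ((s'^-1 - s^-1) * s)%:C + \sum_(j < N) (r j * (s * (s' ^+ j - s ^+ j) -
      j%:R / j.+1%:R * (s' ^+ j.+1 - s ^+ j.+1)))%:C * g ^+ j.+1.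
  rewrite mulrDl -addrA; congr (_ + _).
    by rewrite mulrACA mulVf// mulr1 -rmorphM.
  rewrite /log_correction -sumrB mulr_suml -sumrB; apply: eq_bigr => j _.
  rewrite !exprMn !(rmorphM, rmorphB, rmorphXn)/= ![g ^+ j.+1]exprS.
  ring.
rewrite ImD /= add0r Im_sum (le_trans (ler_norm_sum _ _ _))//.
apply: le_trans (ler_wpM2r (sqr_ge0 _) (cumulant_full_moment_le nr N)).
rewrite mulr_suml; apply: ler_sum => j _.
rewrite ImZ !normrM [X in _ <= X * _]mulrC -[leRHS]mulrA -[leLHS]mulrA; apply: ler_wpM2l => //.
rewrite -[leRHS]mulr1; apply: ler_pM => //.
  by apply: power_primitive_le => //; exact: ltW.
rewrite (le_trans (ler_Im_cnorm _))// cnormX exprn_ile1//; exact: ltW.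
Qed.

Let f N s : R :=
  potential (K N (s%:C * g)) + Im (log_correction N (s%:C * g)).
Let lip s0 : R := s0 ^- 2 / rho + B.

Let radial_step s0 s s' N : (0 < N)%N -> 0 < s0 -> s0 <= s -> s <= s' -> s' <= 1 ->
  `|f N s' - f N s| <= lip s0 * (3 * (rho * B) ^+ N) / v1 * (s' - s) +
    (lip s0 ^+ 2 / v1 ^+ 2 + B) * (s' - s) ^+ 2.
Proof.
move=> N0 s00 ss ss' s1; set L := lip s0.
have s_gt0 : 0 < s by exact: lt_le_trans ss.
have s'_gt0 : 0 < s' by exact: lt_le_trans ss'.
have h0 : 0 <= s' - s by rewrite subr_ge0.
have Bge0 : 0 <= B by rewrite addr_ge0//; have /andP[] := k01.
have v1V u : 0 < u <= 1 -> v1 <= Im (K N (u%:C * g)).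
  move=> u01; apply: le_trans (Im_ktransform_ge N u01).
  have /andP[u0 u1] := u01.
  by rewrite ler_pMr// invf_ge1.
have y := v1V s; have y' := v1V s'.
have {}y : v1 <= Im (K N (s%:C * g)) by apply: y; rewrite s_gt0 (le_trans ss').
have {}y' : v1 <= Im (K N (s'%:C * g)) by apply: y'; rewrite s'_gt0.
set z := K N (s%:C * g) in y *; set z' := K N (s'%:C * g) in y' *.
have h1 := potential_increment v1_gt0 y y'.
have h2 : `|expect mu M (fun t => Im ((z' - z) / (z - t%:C))) -
    Im ((z' - z) * (s%:C * g))| <= L * (3 * (rho * B) ^+ N) / v1 * (s' - s).
  apply: le_trans (expect_resolvent nr mu0 _ N0 _ _ _) _.
  - by rewrite mulf_neq0// eq_complex /= eqxx andbT lt0r_neq0.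
  - by apply: le_trans rho1; apply: ray_le1; rewrite ltW//= (le_trans ss').
  - exact: lt_le_trans y.
  rewrite -/z.
  have L0 := ktransform_lipschitz N s00 ss ss' s1; rewrite -/z -/z' -/L in L0.
  have q0 : 0 <= cnorm (s%:C * g) * B by rewrite mulr_ge0 ?cnorm_ge0.
  have qle : cnorm (s%:C * g) * B <= rho * B.
    by rewrite ler_wpM2r// ray_le1// ltW//= (le_trans ss').
  have z0 : 0 < Im z by exact: lt_le_trans y.
  have a1 : 3 * (cnorm (s%:C * g) * B) ^+ N <= 3 * (rho * B) ^+ N.
    by rewrite ler_wpM2l// lerXn2r// nnegrE// (le_trans q0).
  have a2 : (Im z)^-1 <= v1^-1 by rewrite lef_pV2 ?posrE.
  have a3 : 0 <= 3 * (cnorm (s%:C * g) * B) ^+ N by rewrite mulr_ge0// exprn_ge0.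
  have a4 : 0 <= (Im z)^-1 by rewrite invr_ge0 ltW.
  have -> : L * (3 * (rho * B) ^+ N) / v1 * (s' - s) =
    L * (s' - s) * (3 * (rho * B) ^+ N / v1) by ring.
  rewrite -mulrA.
  exact: ler_pM (cnorm_ge0 _) (mulr_ge0 a3 a4) L0 (ler_pM a3 a4 a1 a2).
have h3 := log_correction_increment N s_gt0 ss' s1.
rewrite -/z -/z' ImB in h3.
have {}h1 : `|potential z' - potential z +
    expect mu M (fun t => Im ((z' - z) / (z - t%:C)))| <=
    L ^+ 2 / v1 ^+ 2 * (s' - s) ^+ 2.
  apply: le_trans h1 _; rewrite [leRHS]mulrAC -exprMn.
  apply: ler_wpM2r; first by rewrite invr_ge0 sqr_ge0.
  rewrite lerXn2r ?nnegrE ?cnorm_ge0//; last exact: ktransform_lipschitz.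
  by rewrite mulr_ge0// addr_ge0// divr_ge0 ?invr_ge0 ?sqr_ge0// ltW.
have -> : f N s' - f N s = potential z' - potential z +
    (Im (log_correction N (s'%:C * g)) - Im (log_correction N (s%:C * g))).
  by rewrite /f opprD addrACA.
apply: le_trans (ler_norm_chain h1 h2 h3) _.
by rewrite [(_ + B) * _]mulrDl [leRHS]addrCA [leRHS]addrA.
Qed.

Let argument_ray s : 0 < s -> argument (s%:C * g)^-1 = argument g^-1.
Proof.
move=> s0; rewrite /argument invfM -(fmorphV (real_complex R)) ImZ.
have -> : Re (s^-1%:C * g^-1) = s^-1 * Re g^-1.
  by case: (g^-1) => x y /=; rewrite mul0r subr0.
by rewrite invfM invrK mulrACA mulVf ?mul1r// lt0r_neq0.
Qed.

Let radial_start N s : 0 < s <= 1 ->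
  `|f N s - argument g^-1| <= s * ((B + `|M|) / v1 + B).
Proof.
move=> /[dup] s01 /andP[s0 s1].
have B0 : 0 <= B by rewrite addr_ge0//; have /andP[] := k01.
have y := Im_ktransform_ge N s01.
have y' : v1 / s <= Im (s%:C * g)^-1.
  rewrite Im_inv ImZ (cnorm_ray (ltW s0)).
  have -> : - (s * Im g) / (s * rho) ^+ 2 = - Im g * rho ^- 2 / s.
    by field; rewrite !lt0r_neq0.
  apply: ler_wpM2r; first by rewrite invr_ge0 ltW.
  by apply: ler_wpM2l; [rewrite oppr_ge0 ltW|rewrite lerBlDr lerDl].
have vs0 : 0 < v1 / s by rewrite divr_gt0.
have sum_le : cnorm (\sum_(j < N) (r j)%:C * (s%:C * g) ^+ j) <= B.
  rewrite (le_trans (ler_cnorm_sum _))//.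
  apply: le_trans (cumulant_full_moment_le nr N); apply: ler_sum => j _.
  rewrite cnormM cnorm_real cnormX mulrC; case: (nat_of_ord j) => [|k].
    by have [_ -> _ _] := nr; rewrite normr0 !mulr0.
  apply: ler_wpM2r => //; apply: (@le_trans _ _ 1); last by rewrite ler1n.
  rewrite exprn_ile1 ?cnorm_ge0//; apply: le_trans rho1.
  by apply: ray_le1; rewrite (ltW s0).
rewrite /f -addrA [Im _ - _]addrC addrA mulrDr (le_trans (ler_normD _ _))//.
apply: lerD.
  have ac := admissible_cst M (argument g^-1).
  have az := admissible_argument (K N (s%:C * g)).
  rewrite /potential -[argument g^-1](expect_cst muM) -expectB//.
  apply: expect_norm_le => //; first exact: admissibleB.
  move=> t tM; rewrite -(argument_ray s0) -normrN opprB.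
  apply: le_trans (argument_lipschitz vs0 _ y') _.
    by rewrite ImB/= subr0.
  rewrite [(v1 / s)^-1]invf_div mulrCA; apply: ler_wpM2l; first exact: ltW.
  apply: ler_wpM2r; first by rewrite invr_ge0; exact: ltW.
  have -> : (s%:C * g)^-1 - (K N (s%:C * g) - t%:C) =
      t%:C - \sum_(j < N) (r j)%:C * (s%:C * g) ^+ j by rewrite /ktransform; ring.
  rewrite (le_trans (ler_cnormB _ _))// addrC cnorm_real lerD//.
  by rewrite (le_trans tM)// ler_norm.
rewrite (le_trans (ler_Im_cnorm _))// (le_trans (ler_cnorm_sum _))//.
apply: le_trans (ler_wpM2l (ltW s0) (cumulant_full_moment_le nr N)).
rewrite mulr_sumr; apply: ler_sum => j _.
rewrite cnormM cnorm_real normrM cnormX (cnorm_ray (ltW s0)).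
have jj : `|j%:R / j.+1%:R| <= j%:R :> R.
  by rewrite ger0_norm ?divr_ge0// ler_pdivrMr// ler_peMr// ler1n.
have -> : s * (j%:R * `|r j|) = `|r j| * (j%:R * s) by ring.
rewrite -mulrA; apply: ler_wpM2l => //.
apply: ler_pM => //; first by rewrite exprn_ge0// mulr_ge0// ltW.
rewrite exprS -[leRHS]mulr1; have sr : s * rho <= s by rewrite ler_piMr// ltW.
apply: ler_pM => //; rewrite ?exprn_ge0 ?mulr_ge0 ?(ltW s0) ?(ltW rho0)//.
rewrite exprn_ile1 ?mulr_ge0 ?(ltW s0) ?(ltW rho0)//.
exact: le_trans sr s1.
Qed.

(** Along the ray s g, the derivative of the potential at K(s g) is, up to sign,
    the imaginary part of g K'(s g) times the Cauchy transform s g, that is of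
    g (s g) (R'(s g) - 1 / (s g)^2), and the second term is real. *)
Theorem potential_ktransform (e : R) : 0 < e -> exists N0, forall N, (N0 <= N)%N ->
  `|potential (K N g) + Im (log_correction N g) - argument g^-1| <= e.
Proof.
move=> e0; have B0 : 0 <= B by rewrite addr_ge0//; have /andP[] := k01.
(* The start s0 of the path is chosen before N, uniformly in N. *)
pose c := (B + `|M|) / v1 + B + 1.
have c0 : 0 < c.
  rewrite ltr_wpDl// addr_ge0// divr_ge0 ?(ltW v1_gt0)// addr_ge0//.
pose s0 := Num.min 1 (e / (2 * c)).
have s00 : 0 < s0 by rewrite lt_min ltr01/= divr_gt0// mulr_gt0.
have s01 : s0 <= 1 by rewrite ge_min lexx.
have s0c : s0 * c <= e / 2.
  apply: (@le_trans _ _ (e / (2 * c) * c)).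
    by apply: ler_wpM2r; [exact: ltW|rewrite ge_min lexx orbT].
  by rewrite le_eqVlt; apply/orP; left; apply/eqP; field; rewrite lt0r_neq0.
have L0 : 0 < lip s0.
  rewrite /lip ltr_wpDr// divr_gt0// invr_gt0 exprn_gt0//.
have L3 : 0 < lip s0 * 3 / v1 by apply: divr_gt0 => //; rewrite mulr_gt0.
have q01 : 0 <= rho * B < 1 by rewrite mulr_ge0 ?(ltW rho0)//= mulrC gB.
have [N0 hN] := geometric_eventually_le q01 (divr_gt0 e0 (mulr_gt0 (ltr0n R 2) L3)).
exists N0.+1 => N NN0; have N_gt0 : (0 < N)%N by exact: leq_ltn_trans NN0.
have {hN} hq := hN N (ltnW NN0).
have -> : potential (K N g) + Im (log_correction N g) = f N 1.
  by rewrite /f [1%:C * g]mul1r.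
rewrite -(subrK (f N s0) (f N 1)) -addrA (le_trans (ler_normD _ _))//.
rewrite [e]splitr lerD//; last first.
  apply: le_trans (radial_start N _) _; first by rewrite s00.
  apply: le_trans s0c; by apply: ler_wpM2l; [exact: ltW|rewrite /c lerDl].
have := @subdivision_le R (f N) s0 1 (lip s0 * (3 * (rho * B) ^+ N) / v1)
  (lip s0 ^+ 2 / v1 ^+ 2 + B) s01.
move=> /(_ _)/le_trans; apply.
  move=> s s' /andP[h1 h2] /andP[h3 h4] h5; exact: radial_step.
have -> : lip s0 * (3 * (rho * B) ^+ N) / v1 = lip s0 * 3 / v1 * (rho * B) ^+ N.
  by ring.
have p0 : 0 <= lip s0 * 3 / v1 * (rho * B) ^+ N.
  by rewrite mulr_ge0 ?(ltW L3)// exprn_ge0//; have /andP[] := q01.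
apply: (@le_trans _ _ (lip s0 * 3 / v1 * (rho * B) ^+ N)).
  by rewrite ler_piMr// lerBlDr lerDl ltW.
apply: le_trans (ler_wpM2l (ltW L3) hq) _.
rewrite le_eqVlt; apply/orP; left; apply/eqP; move: (lip s0 * 3 / v1) L3 => x x0.
by field; rewrite lt0r_neq0.
Qed.

End radial_path.
End potential.

(** * Comparison of the potentials *)

(** The roots of g ^ 2 - w g + 1 have product 1, and none has modulus 1 since w is
    not real. *)
Lemma joukowski_inverse (R : realType) (w : R[i]) : 0 < Im w ->
  exists g, [/\ g != 0, g^-1 + g = w, cnorm g < 1, Im g < 0 &
    Im w <= (cnorm g)^-1 - cnorm g].
Proof.
move=> w0.
have [g [gn0 gw g1]] : exists g, [/\ g != 0, g^-1 + g = w & cnorm g <= 1].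
  pose d := sqrtc (w ^+ 2 - 4%:R).
  have dE : d ^+ 2 = w ^+ 2 - 4%:R by exact: sqr_sqrtc.
  pose g1 := (w + d) / 2%:R; pose g2 := (w - d) / 2%:R.
  have g12 : g1 * g2 = 1.
    have -> : g1 * g2 = (w ^+ 2 - d ^+ 2) / 4%:R by rewrite /g1 /g2; field.
    by rewrite dE; field.
  have g1n0 : g1 != 0.
    by apply/eqP => z; move/eqP: g12; rewrite z mul0r eq_sym oner_eq0.
  have g2n0 : g2 != 0.
    by apply/eqP => z; move/eqP: g12; rewrite z mulr0 eq_sym oner_eq0.
  have sg : g1 + g2 = w by rewrite /g1 /g2; field.
  have [n1|n1] := leP (cnorm g1) 1.
    exists g1; split => //; rewrite addrC -[RHS]sg; congr (_ + _).
    by apply: (mulfI g1n0); rewrite mulfV// g12.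
  exists g2; split => //.
    rewrite -[RHS]sg; congr (_ + _).
    by apply: (mulIf g2n0); rewrite mulVf// g12.
  have := congr1 (fun x => cnorm x) g12; rewrite cnormM ComplexField.Normc.normc1.
  move=> h; have := cnorm_ge0 g2; nra.
have r0 : 0 < cnorm g.
  rewrite lt0r cnorm_ge0 andbT; apply/eqP => h.
  by move: gn0; rewrite (ComplexField.Normc.eq0_normc h) eqxx.
have Imw : Im w = - Im g * (cnorm g ^- 2 - 1).
  by rewrite -gw ImD Im_inv; ring.
have glt1 : cnorm g < 1.
  rewrite lt_neqAle g1 andbT; apply/eqP => h.
  by move: w0; rewrite Imw h expr1n invr1 subrr mulr0 ltxx.
have q0 : 0 < cnorm g ^- 2 - 1.
  by rewrite subr_gt0 -[cnorm g ^- 2]mul1r ltr_pdivlMr ?exprn_gt0// mul1r expr_lt1// ltW.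
exists g; split => //.
  by move: w0; rewrite Imw pmulr_lgt0// oppr_gt0.
rewrite Imw; have -> : (cnorm g)^-1 - cnorm g = cnorm g * (cnorm g ^- 2 - 1).
  by field; rewrite lt0r_neq0.
apply: ler_wpM2r; first exact: ltW.
by rewrite (le_trans _ (ler_Im_cnorm g))// -normrN ler_norm.
Qed.

Section comparison.
Context {R : realType}.
Implicit Types (z w D g : R[i]).

Definition semicircular_cumulant k : R := (k == 1)%N%:R.

Lemma near_semicircular0 : near_semicircular semicircular_cumulant 0.
Proof.
split; rewrite ?lexx ?ler01// => -[|[|k]]// _.
by rewrite /semicircular_cumulant /= normr0 mul0r.
Qed.

Variables (om : probability (measurableTypeR R) R) (M' : R).
Hypothesis omM : carried om M'.
Hypothesis om0 : forall k, poly_expect omM (cumulant_poly semicircular_cumulant k.+1) = 0.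

Lemma ktransform_semicircular N g : (1 < N)%N ->
  ktransform semicircular_cumulant N g = g^-1 + g.
Proof.
case: N => [|[|N]]// _; rewrite /ktransform !big_ord_recl big1 => [|j _].
  by rewrite /semicircular_cumulant/= mul0r add0r addr0 expr1 mul1r.
by rewrite /semicircular_cumulant /bump/= mul0r.
Qed.

Let expect_resolvent_le z D : 0 < Im z ->
  `|expect om M' (fun t => Im (D / (z - t%:C)))| <= cnorm D.
Proof.
move=> z0; have [g [gn0 gz g1 _ _]] := joukowski_inverse z0.
set e := expect _ _ _; apply/ler_addgt0Pr => d d0.
pose c := cnorm D * 3 / Im z + 1.
have c0 : 0 < c.
  by rewrite ltr_wpDl// divr_ge0 ?(ltW z0)// mulr_ge0 ?cnorm_ge0.
have q01 : 0 <= cnorm g < 1 by rewrite cnorm_ge0.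
have [N0 hN] := geometric_eventually_le q01 (divr_gt0 d0 c0).
pose N := N0.+2; have {hN} hq := hN N (leq_trans (leqnSn _) (leqnSn _)).
have kz : ktransform semicircular_cumulant N g = z by rewrite ktransform_semicircular.
have := @expect_resolvent _ _ _ _ _ omM near_semicircular0 om0 N g D isT gn0 (ltW g1).
rewrite kz => /(_ z0); rewrite addr0 mulr1 -/e => h.
have h2 : `|Im (D * g)| <= cnorm D.
  rewrite (le_trans (ler_Im_cnorm _))// cnormM.
  by rewrite ler_piMr ?cnorm_ge0// ltW.
rewrite -(subrK (Im (D * g)) e) (le_trans (ler_normD _ _))// addrC lerD//.
apply: le_trans h _.
have -> : cnorm D * (3 * cnorm g ^+ N) / Im z = cnorm D * 3 / Im z * cnorm g ^+ N.
  by ring.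
apply: (@le_trans _ _ (c * (d / c))); last by rewrite mulrC divfK// lt0r_neq0.
apply: ler_pM => //; last by rewrite /c lerDl.
- by rewrite divr_ge0 ?(ltW z0)// mulr_ge0 ?cnorm_ge0.
- by rewrite exprn_ge0// cnorm_ge0.
Qed.

(** The Cauchy transform of the semicircle law is bounded by 1. *)
Lemma potential_semicircular_lipschitz z w v : 0 < v -> v <= Im z -> v <= Im w ->
  `|potential om M' z - potential om M' w| <= cnorm (z - w).
Proof.
move=> v0 vz vw.
pose p s := w + s%:C * (z - w); pose f s := potential om M' (p s).
have pv s : 0 <= s <= 1 -> v <= Im (p s).
  move=> /andP[s0 s1]; rewrite /p ImD ImZ ImB.
  have := ler_wpM2l s0 vz; have := @ler_wpM2l _ (1 - s) _ _ _ vw.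
  by rewrite subr_ge0 => /(_ s1); lra.
have := @subdivision_le R f 0 1 (cnorm (z - w)) (cnorm (z - w) ^+ 2 / v ^+ 2) ler01.
have -> : f 1 = potential om M' z by rewrite /f /p [1%:C * _]mul1r addrC subrK.
have -> : f 0 = potential om M' w by rewrite /f /p [0%:C * _]mul0r addr0.
rewrite subr0 mulr1; apply=> s s' s01 s'01 ss'.
have pp : p s' - p s = (s' - s)%:C * (z - w) by rewrite /p rmorphB/=; ring.
have cpp : cnorm (p s' - p s) = cnorm (z - w) * (s' - s).
  by rewrite pp cnormM cnorm_real ger0_norm ?subr_ge0// mulrC.
have h1 := potential_increment omM v0 (pv s s01) (pv s' s'01).
have h2 := expect_resolvent_le (p s' - p s) (lt_le_trans v0 (pv s s01)).
rewrite cpp in h1 h2; rewrite /f.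
move: h1 h2; set e := expect _ _ _; set a := _ - _ => h1 h2.
rewrite -(addrK e a) (le_trans (ler_normB _ _))// addrC lerD//.
by apply: le_trans h1 _; rewrite exprMn mulrAC.
Qed.

Variables (mu : probability (measurableTypeR R) R) (M : R).
Variables (r : nat -> R) (kappa : R).
Hypothesis muM : carried mu M.
Hypothesis nr : near_semicircular r kappa.
Hypothesis mu0 : forall k, poly_expect muM (cumulant_poly r k.+1) = 0.
Hypothesis kappa_gt0 : 0 < kappa.

Let cumulant_diff_le N (c : nat -> R) (h : nat -> R[i]) :
  (forall j, 0 <= c j <= 1) -> (forall j, cnorm (h j) <= 1) ->
  cnorm (\sum_(j < N) (r j * c j)%:C * h j -
    \sum_(j < N) (semicircular_cumulant j * c j)%:C * h j) <= kappa.
Proof.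
move=> c01 h1; rewrite -sumrB (le_trans (ler_cnorm_sum _))//.
have [_ r0 r1 _] := nr.
apply: le_trans (cumulant_sum_le nr N); rewrite [leRHS]big_mkcond/=.
apply: ler_sum => -[[|[|j]] jN] _ /=.
- by rewrite r0 /semicircular_cumulant/= subrr ComplexField.Normc.normc0.
- by rewrite r1 /semicircular_cumulant/= subrr ComplexField.Normc.normc0.
rewrite /semicircular_cumulant/= mul0r [0%:C * _]mul0r subr0 cnormM cnorm_real.
have /andP[c0 c1] := c01 j.+2.
rewrite normrM (ger0_norm c0) -mulrA ler_piMr//.
by rewrite mulr_ile1// cnorm_ge0.
Qed.

(** With w = g + 1/g and z = K(g), the potential of mu at z and that of the
    semicircle law at w agree up to the cumulants of index at least 2. The height
    4 kappa of w ensures (1 + kappa) |g| < 1. *)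
Lemma potential_close w : Im w = 4 * kappa ->
  exists2 z, cnorm (z - w) <= kappa &
    `|potential mu M z - potential om M' z| <= 3 * kappa.
Proof.
move=> Imw; have k0 := kappa_gt0; have [/andP[_ k1] _ _ _] := nr.
have w0 : 0 < Im w by rewrite Imw mulr_gt0.
have [g [gn0 gw g1 Img gle]] := joukowski_inverse w0.
have rho0 : 0 < cnorm g.
  by apply: lt_le_trans (ler_Im_cnorm g); rewrite normr_gt0 lt_eqF.
have gB : (1 + kappa) * cnorm g < 1.
  rewrite ltNge; apply/negP => h.
  have : (cnorm g)^-1 <= 1 + kappa by rewrite -[leLHS]mul1r ler_pdivrMr.
  have : 1 - kappa <= cnorm g by have := cnorm_ge0 g; nra.
  by move: gle; rewrite Imw; lra.
have gB0 : (1 + 0) * cnorm g < 1 by rewrite addr0 mul1r.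
have e0 : 0 < kappa / 2 by rewrite divr_gt0.
have [N1 h1] := potential_ktransform nr mu0 Img gB e0.
have [N2 h2] := potential_ktransform near_semicircular0 om0 Img gB0 e0.
pose N := (N1 + N2).+2.
have {}h1 := h1 N (leq_trans (leq_addr N2 N1) (leq_trans (leqnSn _) (leqnSn _))).
have {}h2 := h2 N (leq_trans (leq_addl N1 N2) (leq_trans (leqnSn _) (leqnSn _))).
have kw : ktransform semicircular_cumulant N g = w by rewrite ktransform_semicircular.
set z := ktransform r N g in h1 *.
have zw : cnorm (z - w) <= kappa.
  rewrite -kw /z /ktransform opprD addrACA subrr add0r.
  have := @cumulant_diff_le N (fun=> 1) (fun j => g ^+ j).
  under eq_bigr do rewrite mulr1.
  under [X in _ - X]eq_bigr do rewrite mulr1.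
  apply => j; first by rewrite ler01 lexx.
  by rewrite cnormX exprn_ile1// ?cnorm_ge0// ltW.
exists z => //.
have vz : 3 * kappa <= Im z.
  have := le_trans (ler_Im_cnorm (z - w)) zw.
  by rewrite ImB Imw ler_norml => /andP[]; lra.
have vw : 3 * kappa <= Im w by rewrite Imw; lra.
have h3 := le_trans (potential_semicircular_lipschitz (mulr_gt0 (ltr0n R 3) k0) vz vw) zw.
have h4 : `|Im (log_correction r N g) -
    Im (log_correction semicircular_cumulant N g)| <= kappa.
  rewrite -ImB (le_trans (ler_Im_cnorm _))//.
  apply: (@cumulant_diff_le N (fun j => j%:R / j.+1%:R) (fun j => g ^+ j.+1)) => j.
    by rewrite divr_ge0//= ler_pdivrMr// mul1r ler_nat.
  by rewrite cnormX exprn_ile1// ?cnorm_ge0// ltW.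
move: h1 h2 h3 h4; rewrite kw !ler_norml.
move=> /andP[? ?] /andP[? ?] /andP[? ?] /andP[? ?]; apply/andP; split; lra.
Qed.

End comparison.

(** * The semicircle law *)

Section semicircle_law.
Context {R : realType}.
Local Notation leb := (@lebesgue_measure R).
Local Notation om := (@semicircle R).
Local Notation U := (cumulant_poly (@semicircular_cumulant R)).

Lemma semicircle_dominates : om `<< leb.
Proof.
apply/null_content_dominatesP => A mA A0; rewrite /semicircle.
apply: null_set_integral => //; apply: measurable_funTS.
apply: measurableT_comp => //; exact: measurable_semicircle_pdf.
Qed.

Lemma integral_semicircle (f : R -> \bar R) (D : set R) :
  measurable D -> om.-integrable D f ->
  (\int[om]_(x in D) f x = \int[leb]_(x in D) (f x * (semicircle_pdf x)%:E))%E.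
Proof.
move=> mD If; have mf := measurable_int _ If.
have mpdf E : measurable_fun E (fun x : R => (semicircle_pdf x)%:E).
  by apply: measurable_funTS; apply: measurableT_comp => //;
    exact: measurable_semicircle_pdf.
have Ipdf : leb.-integrable setT (fun x : R => (semicircle_pdf x)%:E).
  apply/integrableP; split; first exact: mpdf.
  apply: (@le_lt_trans _ _ (om setT)); last by rewrite probability_setT ltry.
  rewrite le_eqVlt; apply/orP; left; apply/eqP; apply: eq_integral => x _.
  by rewrite gee0_abs// lee_fin semicircle_pdf_ge0.
rewrite -(Radon_Nikodym_change_of_variables semicircle_dominates)//=.
apply: ae_eq_integral => //.
- apply: emeasurable_funM => //; apply: (measurable_int leb).
  apply: (integrableS _ _ (@subsetT _ _)) => //=.
  by apply: Radon_Nikodym_integrable; exact: semicircle_dominates.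
- by apply: emeasurable_funM => //; exact: mpdf.
apply: ae_eqe_mul2l => /=; rewrite Radon_NikodymE//=.
  exact: semicircle_dominates.
move=> dom; case: cid => /= h [h1 h2 h3].
apply: integral_ae_eq => //=.
- exact: integrableS h2.
- exact: mpdf.
- by move=> E ED mE; exact: (esym (h3 E mE)).
Qed.

Lemma semicircle_pdf_out (x : R) : 2 < `|x| -> semicircle_pdf x = 0.
Proof.
move=> x2; rewrite /semicircle_pdf ler0_sqrtr ?mulr0// subr_le0.
by rewrite -[x ^+ 2]real_normK ?num_real//; nra.
Qed.

Lemma carried_semicircle : carried om 2.
Proof.
rewrite /carried /= /semicircle; apply: integral0_eq => x /= xM; congr EFin.
apply: semicircle_pdf_out; rewrite ltNge; apply/negP => h; apply: xM.
by rewrite in_itv/= -ler_norml.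
Qed.

Lemma semicircle_pdf_le1 (x : R) : semicircle_pdf x <= 1.
Proof.
have p0 := pi_gt0 R; have p2 := pi_ge2 R.
rewrite /semicircle_pdf ler_pdivrMl ?mulr_gt0// mulr1.
apply: (@le_trans _ _ 2); last lra.
rewrite -[leRHS](@ger0_norm _ 2)// -sqrtr_sqr ler_wsqrtr//.
by have := sqr_ge0 x; rewrite !expr2; lra.
Qed.

Lemma semicircle_cdf_lipschitz (x y : R) : x <= y ->
  fine (om `]-oo, y]%classic) <= fine (om `]-oo, x]%classic) + (y - x).
Proof.
move=> xy.
have mI (i : interval R) : measurable ([set` i] : set (measurableTypeR R)).
  exact: measurable_itv.
have fin (A : set (measurableTypeR R)) : measurable A -> om A \is a fin_num.
  by move=> mA; exact: fin_num_measure.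
have -> : `]-oo, y]%classic = `]-oo, x]%classic `|` `]x, y]%classic :> set R.
  apply/seteqP; split => z /=; rewrite !in_itv/=.
    by move=> zy; have [zx|xz] := leP z x; [left|right; apply/andP].
  by move=> [zx|/andP[_ //]]; exact: le_trans xy.
rewrite measureU//; last first.
  apply/seteqP; split => z //= []; rewrite !in_itv/= => zx /andP[xz _].
  by move: (lt_le_trans xz zx); rewrite ltxx.
rewrite fineD ?fin// lerD2l -lee_fin fineK ?fin// /semicircle.
apply: (@le_trans _ _ (\int[leb]_(z in `]x, y]) 1)%E).
  apply: ge0_le_integral => //=.
  - by move=> z _; rewrite lee_fin semicircle_pdf_ge0.
  - apply: measurable_funTS; apply: measurableT_comp => //.
    exact: measurable_semicircle_pdf.
  - by move=> z _; rewrite lee_fin semicircle_pdf_le1.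
rewrite integral_cst//= mul1e lebesgue_measure_itv/= lte_fin.
by case: ifP => // _; rewrite lee_fin subr_ge0.
Qed.

Lemma chebyshev_rec k : U k.+2 = 'X * U k.+1 - U k.
Proof.
rewrite cumulant_polyS !big_ord_recl big1 => [|j _].
  by rewrite /semicircular_cumulant/= scale0r add0r addr0 scale1r /bump/= subSS subn0.
by rewrite /semicircular_cumulant /bump/= scale0r.
Qed.

Lemma chebyshev1 : U 1 = 'X.
Proof.
rewrite cumulant_polyS big_ord1 cumulant_poly0 mulr1.
by rewrite /semicircular_cumulant scale0r subr0.
Qed.

(** Up to scaling, these are the Chebyshev polynomials of the second kind. *)
Lemma chebyshevE k (th : R) :
  (U k).[2 * cos th] * sin th = sin (k.+1%:R * th).
Proof.
suff : (U k).[2 * cos th] * sin th = sin (k.+1%:R * th) /\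
  (U k.+1).[2 * cos th] * sin th = sin (k.+2%:R * th) by case.
elim: k => [|k [IH1 IH2]].
  rewrite cumulant_poly0 chebyshev1 hornerC hornerX !mul1r; split => //.
  have -> : 2%:R * th = th + th by ring.
  by rewrite sinD; ring.
split => //; rewrite chebyshev_rec hornerD hornerN hornerM hornerX mulrBl IH1.
rewrite -mulrA IH2.
have -> : k.+3%:R * th = k.+2%:R * th + th by rewrite -[k.+3%:R]natr1; ring.
have -> : k.+1%:R * th = k.+2%:R * th - th by rewrite -[k.+2%:R]natr1; ring.
by rewrite sinB sinD; ring.
Qed.

Let sin_natpi n : sin (n%:R * pi) = 0 :> R.
Proof.
elim: n => [|n IH]; first by rewrite mul0r sin0.
by rewrite -natr1 mulrDl mul1r sinDpi IH oppr0.
Qed.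

Lemma expect_chebyshev k : poly_expect carried_semicircle (U k.+1) = 0.
Proof.
have p0 := pi_gt0 R.
pose G x := (U k.+1).[x] * semicircle_pdf x.
have cG : continuous G.
  by move=> x; apply: cvgM; [exact: continuous_horner|exact: continuous_semicircle_pdf].
pose F (t : R) := 2 * sin t.
have dF (t : R) : is_derive t 1 F (2 * cos t).
  by rewrite /F; apply: is_derive_eq; rewrite /GRing.scale/=.
have dFE : derive1 F = (fun t => 2 * cos t).
  by apply/funext => t; rewrite derive1E; apply: derive_val.
have cF' : continuous (fun t : R => 2 * cos t).
  by move=> t; apply: cvgM; [exact: cvg_cst|exact: continuous_cos].
have cF : continuous F.
  by move=> t; apply: cvgM; [exact: cvg_cst|exact: continuous_sin].
have LR (g : R -> R) (a b : R) : (forall t, derivable g t 1) -> continuous g ->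
    derivable_oo_LRcontinuous g a b.
  move=> dg cg; split => [x _||]; first exact: dg.
    exact: cvg_at_right_filter (cg a).
  exact: cvg_at_left_filter (cg b).
pose wave a (t : R) := sin (a * (pi / 2 - t)).
have dwave a (t : R) : is_derive t 1 (wave a) (- (a * cos (a * (pi / 2 - t)))).
  have h : is_derive t 1 (fun t : R => a * (pi / 2 - t)) (- a).
    by apply: is_derive_eq; rewrite /GRing.scale/=; ring.
  have := @is_derive1_comp _ sin (fun t : R => a * (pi / 2 - t)) t _ _ (is_derive_sin _) h.
  by move=> d; apply: (is_derive_eq d); ring.
pose a : R := k.+1%:R; pose b : R := k.+3%:R.
pose H t := - pi^-1 * (a^-1 * wave a t - b^-1 * wave b t).
have dH (t : R) : is_derive t 1 H (2 / pi * cos t * sin (k.+2%:R * (pi / 2 - t))).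
  rewrite /H; apply: is_derive_eq; rewrite /GRing.scale/=.
  have a0 : a != 0 by rewrite pnatr_eq0.
  have b0 : b != 0 by rewrite pnatr_eq0.
  have -> : cos t = sin (pi / 2 - t) by rewrite sinB cos_pihalf sin_pihalf; ring.
  move: (pi / 2 - t) => th.
  have -> : a * th = k.+2%:R * th - th by rewrite /a -[k.+2%:R]natr1; ring.
  have -> : b * th = k.+2%:R * th + th by rewrite /b -[k.+3%:R]natr1; ring.
  rewrite cosB cosD; move: (a) (b) a0 b0 => x y x0 y0.
  by move: (pi^-1) => c; field; rewrite x0 y0.
have cH : continuous H.
  by move=> t; apply: differentiable_continuous; apply/derivable1_diffP; have [] := dH t.
rewrite /poly_expect /expect /Rintegral.
rewrite integral_semicircle//; last first.
  by apply: admissible_integrable; [exact: carried_semicircle|exact: admissible_horner].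
have -> : (\int[leb]_(x in `[(- 2)%R, 2%R]) ((U k.+1).[x]%:E * (semicircle_pdf x)%:E) =
    \int[leb]_(x in `[F (- (pi / 2))%R, F (pi / 2)%R]) (G x)%:E)%E.
  by rewrite /F sinN sin_pihalf mulrN mulr1.
rewrite (@integration_by_substitution_increasing _ F).
- rewrite dFE.
  transitivity (fine (\int[leb]_(t in `[(- (pi / 2))%R, (pi / 2)%R])
      (2 / pi * cos t * sin (k.+2%:R * (pi / 2 - t)))%:E)%E).
    congr fine; apply: eq_integral => t; rewrite inE/= in_itv/= => tpi; congr EFin.
    rewrite /G /F /= mulrfctE /= /semicircle_pdf.
    have -> : 4 - (2 * sin t) ^+ 2 = (2 * cos t) ^+ 2.
      by rewrite [in RHS]exprMn cos2sin2; ring.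
    rewrite sqrtr_sqr ger0_norm ?mulr_ge0 ?cos_ge0_pihalf//.
    have sE : sin (pi / 2 - t) = cos t by rewrite sinB cos_pihalf sin_pihalf; ring.
    have cE : cos (pi / 2 - t) = sin t by rewrite cosB cos_pihalf sin_pihalf; ring.
    have <- := chebyshevE k.+1 (pi / 2 - t); rewrite sE cE.
    by rewrite [(2 * pi)^-1]invfM; move: (pi^-1) => c; field.
  rewrite (@continuous_FTC2 _ _ H).
  + have Hp : H (pi / 2) = 0 by rewrite /H /wave !(subrr, mulr0, sin0).
    have Hm : H (- (pi / 2)) = 0.
      have pp : pi / 2 - - (pi / 2) = pi :> R by lra.
      by rewrite /H /wave pp !sin_natpi !mulr0 subrr mulr0.
    by rewrite Hp Hm sube0.
  + lra.
  + apply: continuous_subspaceT => t; apply: cvgM.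
      by apply: cvgM; [exact: cvg_cst|exact: continuous_cos].
    apply: (@continuous_comp _ _ _ (fun t : R => k.+2%:R * (pi / 2 - t)) sin).
      apply: cvgM; first exact: cvg_cst.
      by apply: cvgB; [exact: cvg_cst|exact: cvg_id].
    exact: continuous_sin.
  + by apply: LR => // t; have [] := dH t.
  + by move=> t _; rewrite derive1E; apply: derive_val.
- lra.
- by move=> x y xI yI xy; rewrite /F ltr_pM2l// ltr_sin.
- by move=> t _; rewrite dFE; exact: cF'.
- by rewrite dFE; apply/cvg_ex; eexists; apply: cvg_at_right_filter; exact: cF'.
- by rewrite dFE; apply/cvg_ex; eexists; apply: cvg_at_left_filter; exact: cF'.
- by apply: LR => // t; have [] := dF t.
- by apply: continuous_subspaceT; exact: cG.
Qed.

End semicircle_law.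

(** * From potentials to distribution functions *)

Lemma staircase_count (R : realDomainType) n (y : R) : 0 <= y -> y <= n.+1%:R ->
  `|y - \sum_(j < n) ((j.+1%:R <= y)%R%:R : R)| <= 1.
Proof.
elim: n => [|n IH] y0 yn; first by rewrite big_ord0 subr0 ger0_norm.
rewrite big_ord_recr/=; have [ny|yn'] := leP n.+1%:R y; last first.
  by rewrite addr0 IH// ltW.
rewrite (eq_bigr (fun=> 1)) => [|j _]; last first.
  by rewrite (le_trans _ ny)// ler_nat ltnW// ltnS.
rewrite sumr_const card_ord; move: yn ny; rewrite -!natr1 => yn ny.
rewrite ger0_norm; lra.
Qed.

Section smoothing.
Context {R : realType}.

Definition distrib_fun (mu : probability (measurableTypeR R) R) (x : R) : R :=
  fine (mu `]-oo, x]%classic).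

Lemma distrib_fun_le mu x y : x <= y -> distrib_fun mu x <= distrib_fun mu y.
Proof.
move=> xy; rewrite /distrib_fun fine_le ?fin_num_measure// le_measure ?inE//=.
by move=> z /=; rewrite !in_itv/= => zx; exact: le_trans xy.
Qed.

Lemma distrib_fun_ge0 mu x : 0 <= distrib_fun mu x.
Proof. by rewrite /distrib_fun fine_ge0. Qed.

Lemma distrib_fun_le1 mu x : distrib_fun mu x <= 1.
Proof.
rewrite /distrib_fun -[leRHS]/(fine 1%:E) fine_le ?fin_num_measure//.
by apply: probability_le1.
Qed.

Lemma distrib_fun_dist_le1 mu om x : `|distrib_fun mu x - distrib_fun om x| <= 1.
Proof.
have := distrib_fun_ge0 mu x; have := distrib_fun_ge0 om x.
have := distrib_fun_le1 mu x; have := distrib_fun_le1 om x.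
by rewrite ler_norml => h1 h2 h3 h4; apply/andP; split; lra.
Qed.

(** Quantiles of the standard Cauchy law, and of the one with location Re z and
    scale Im z. *)
Definition cauchy_slope n j : R := tan (pi * (j.+1%:R / n.+1%:R - 1 / 2)).
Definition cauchy_point (z : R[i]) n j : R := Re z - Im z * cauchy_slope n j.

Lemma atan_cauchy_slope n j : (j < n)%N ->
  atan (cauchy_slope n j) = pi * (j.+1%:R / n.+1%:R - 1 / 2).
Proof.
move=> jn; have p0 := pi_gt0 R; rewrite /cauchy_slope tanK//.
have n0 : (0 : R) < n.+1%:R by [].
have h0 : 0 < (j.+1%:R / n.+1%:R : R) by rewrite divr_gt0.
have h1 : (j.+1%:R / n.+1%:R : R) < 1 by rewrite ltr_pdivrMr// mul1r ltr_nat.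
rewrite in_itv/=; move: (j.+1%:R / n.+1%:R) h0 h1 => x h0 h1.
have q1 := mulr_gt0 p0 h0; have q2 : 0 < pi * (1 - x) by rewrite mulr_gt0// subr_gt0.
by apply/andP; split; lra.
Qed.

(** As a function of t, argument (z - t) / pi + 1/2 is the survival function of that
    Cauchy law, which is within 1 / (n + 1) of a step function with equal jumps at
    its quantiles. *)
Lemma staircase_potential (mu : probability (measurableTypeR R) R) M z n :
  carried mu M -> 0 < Im z ->
  `|n.+1%:R * (potential mu M z / pi + 1 / 2) -
    \sum_(j < n) distrib_fun mu (cauchy_point z n j)| <= 1.
Proof.
move=> muM z0; have p0 := pi_gt0 R.
have aA := admissible_argument M z.
have aI (j : 'I_n) := admissible_indic M (cauchy_point z n j).
pose f (t : R) : R := n.+1%:R / pi * argument (z - t%:C) + n.+1%:R * (1 / 2) -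
  \sum_(j < n) ((t <= cauchy_point z n j)%R%:R : R).
have aZ : admissible M (fun t => n.+1%:R / pi * argument (z - t%:C)).
  by apply: admissibleM => //; exact: admissible_cst.
have aC := admissible_cst M (n.+1%:R * (1 / 2) : R).
have aS : admissible M (fun t => \sum_(j < n) ((t <= cauchy_point z n j)%R%:R : R)).
  exact: admissible_sum.
have af : admissible M f by apply: admissibleB => //; exact: admissibleD.
have -> : n.+1%:R * (potential mu M z / pi + 1 / 2) -
    \sum_(j < n) distrib_fun mu (cauchy_point z n j) = expect mu M f.
  rewrite /f expectB//; last exact: admissibleD.
  rewrite expectD// expectZ// expect_cst// expect_sum//; congr (_ - _).
    by rewrite /potential mulrDr mulrA mulrAC.
  by apply: eq_bigr => j _; rewrite expect_indic.
apply: expect_norm_le => // t _; rewrite /f.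
set a := argument (z - t%:C).
have -> : n.+1%:R / pi * a + n.+1%:R * (1 / 2) = n.+1%:R * (a / pi + 1 / 2).
  by rewrite [RHS]mulrDr; congr (_ + _); rewrite mulrAC -mulrA.
have a1 : - (pi / 2) < a by exact: atan_gtNpi2.
have a2 : a < pi / 2 by exact: atan_ltpi2.
have b1 : - (1 / 2) <= a / pi by rewrite ler_pdivlMr//; lra.
have b2 : a / pi <= 1 / 2 by rewrite ler_pdivrMr//; lra.
have n0 : (0 : R) < n.+1%:R by [].
rewrite (eq_bigr (fun j : 'I_n => ((j.+1%:R <= n.+1%:R * (a / pi + 1 / 2))%R%:R : R))).
  by apply: staircase_count; nra.
move=> j _; congr ((_ : bool)%:R).
have jn := ltn_ord j; have sj := atan_cauchy_slope jn.
have -> : (t <= cauchy_point z n j) = (cauchy_slope n j <= (Re z - t) / Im z).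
  rewrite ler_pdivlMr// /cauchy_point; apply/idP/idP; lra.
have -> : (cauchy_slope n j <= (Re z - t) / Im z) =
    (atan (cauchy_slope n j) <= a).
  have -> : a = atan ((Re z - t) / Im z) by rewrite /a /argument ReB ImB/= subr0.
  apply/idP/idP; first exact: le_atan.
  by rewrite leNgt => h; rewrite leNgt; apply: contra h; exact: lt_atan.
rewrite sj -[RHS](ler_pM2l p0); have -> : pi * (n.+1%:R * (a / pi + 1 / 2)) =
    n.+1%:R * (a + pi / 2).
  have ap : pi * (a / pi) = a by rewrite mulrC divfK// lt0r_neq0.
  by rewrite mulrCA mulrDr ap [pi * (1 / 2)]mulrA mulr1.
rewrite -[LHS](ler_pM2l n0).
have -> : n.+1%:R * (pi * (j.+1%:R / n.+1%:R - 1 / 2)) =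
    pi * j.+1%:R - n.+1%:R * (pi / 2) :> R.
  have nj : n.+1%:R * (j.+1%:R / n.+1%:R) = j.+1%:R :> R.
    by rewrite mulrC divfK// lt0r_neq0.
  have gen (q y b c : R) : b * y = c -> b * (q * (y - 1 / 2)) = q * c - b * (q / 2).
    by move=> <-; ring.
  exact: gen.
by rewrite mulrDr; apply/idP/idP; lra.
Qed.

Variables (mu om : probability (measurableTypeR R) R) (M M' kappa : R).
Hypothesis muM : carried mu M.
Hypothesis omM : carried om M'.
Hypothesis om_lip : forall x y, x <= y -> distrib_fun om y <= distrib_fun om x + (y - x).
Hypothesis kappa0 : 0 < kappa.
Hypothesis close : forall w : R[i], Im w = 4 * kappa ->
  exists2 z : R[i], cnorm (z - w) <= kappa &
    `|potential mu M z - potential om M' z| <= 3 * kappa.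

Local Notation A := (tan (3 / 8 * pi) : R).
Local Notation delta x := (distrib_fun mu x - distrib_fun om x).

Let atanA : atan A = 3 / 8 * pi.
Proof.
rewrite tanK// in_itv/=; move: (pi_gt0 R); move: pi => q q0.
by apply/andP; split; lra.
Qed.

Let A0 : 0 <= A.
Proof.
rewrite leNgt; apply/negP => /(@lt_atan R); rewrite atanA atan0 => h.
by have p0 := pi_gt0 R; lra.
Qed.

Let central_slope k j : (j < 6 * k + 7)%N ->
  `|cauchy_slope (8 * k + 7) (k + j)| <= A.
Proof.
move=> jk; have p0 := pi_gt0 R.
have sj := @atan_cauchy_slope (8 * k + 7) (k + j) ltac:(lia).
set s := cauchy_slope _ _ in sj *.
have n0 : (0 : R) < (8 * k + 7).+1%:R by [].
have h0 : 1 / 8 <= ((k + j).+1%:R / (8 * k + 7).+1%:R : R).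
  rewrite ler_pdivlMr// mulrC -ler_pdivlMr ?divr_gt0// div1r invrK.
  by rewrite -natrM ler_nat; lia.
have h1 : ((k + j).+1%:R / (8 * k + 7).+1%:R : R) <= 7 / 8.
  rewrite ler_pdivrMr// mulrAC ler_pdivlMr//.
  by rewrite -!natrM ler_nat; lia.
move: sj h0 h1; move: (_ / _) => x sj h0 h1.
have q0 := ler_wpM2l (ltW p0) h0; have q1 := ler_wpM2l (ltW p0) h1.
rewrite ler_norml; apply/andP; split.
  rewrite leNgt; apply/negP => /(@lt_atan R); rewrite atanN atanA sj => h; lra.
rewrite leNgt; apply/negP => /(@lt_atan R); rewrite atanA sj => h; lra.
Qed.

Let sum_distance_le z k : 3 * kappa <= Im z ->
  `|potential mu M z - potential om M' z| <= 3 * kappa ->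
  `|\sum_(j < 8 * k + 7) delta (cauchy_point z (8 * k + 7) j)| <=
    2 + 3 * (8 * k + 8)%:R * kappa.
Proof.
move=> z3 pz; have k0 := kappa0; have z0 : 0 < Im z by lra.
have h1 := staircase_potential (8 * k + 7) muM z0.
have h2 := staircase_potential (8 * k + 7) omM z0.
rewrite sumrB; have p2 := pi_ge2 R; have p0 := pi_gt0 R.
have : `|(8 * k + 7).+1%:R * (potential mu M z / pi + 1 / 2) -
    (8 * k + 7).+1%:R * (potential om M' z / pi + 1 / 2)| <=
    (8 * k + 7).+1%:R * (3 * kappa).
  rewrite -mulrBr normrM ger0_norm//; apply: ler_wpM2l => //.
  rewrite opprD addrACA subrr addr0 -mulrBl normrM normfV (gtr0_norm p0).
  by apply: le_trans pz; rewrite ler_piMr// invf_le1//; lra.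
move: h1 h2; rewrite -addnS.
set a := _ * (potential mu M z / pi + _); set b := _ * (potential om M' z / pi + _).
set c := \sum_(i < _) distrib_fun mu _; set d := \sum_(i < _) distrib_fun om _.
have -> : (8 * k + 8)%:R * (3 * kappa) = 3 * (8 * k + 8)%:R * kappa by ring.
set e := 3 * _ * kappa.
rewrite !ler_norml => /andP[? ?] /andP[? ?] /andP[? ?].
by apply/andP; split; lra.
Qed.

(** A central window of Cauchy quantiles of fixed proportion 3/4 lies on one side
    of x at a distance of order kappa, where delta is at least its value at x up to
    that order by monotonicity of the one and regularity of the other distribution
    function; on the other quantiles the a priori bound is used. *)
Let improve D x : (forall y, `|delta y| <= D) ->
  `|delta x| <= D / 3 + (7 + 10 * A) * kappa.
Proof.
move=> hD; have k0 := kappa0; have A_ge0 := A0.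
(* The discretization error 2 / (6 k + 7) has to be at most kappa. *)
pose k := Num.truncn kappa^-1.
have kk : 2 / (6 * k + 7)%:R <= kappa.
  have h : kappa^-1 < k.+1%:R by exact: truncnS_gt.
  rewrite ler_pdivrMr// -ler_pdivrMl//.
  have : (2 * k.+1%:R : R) <= (6 * k + 7)%:R by rewrite -natrM ler_nat; lia.
  rewrite mulrC; have : 2 * kappa^-1 <= 2 * k.+1%:R by rewrite ler_wpM2l// ltW.
  lra.
pose m : R := (6 * k + 7)%:R.
have m0 : 0 < m by rewrite ltr0n; lia.
have kD : k%:R * D * 2 <= m * (D / 3).
  have D0 : 0 <= D by exact: le_trans (hD x).
  have : k%:R * 6 <= m by rewrite -natrM ler_nat; lia.
  nra.
have km : (2 + 3 * (8 * k + 8)%:R * kappa) <= m * (5 * kappa).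
  have -> : m * (5 * kappa) = m * kappa + 4 * m * kappa by ring.
  apply: lerD; first by move: kk; rewrite ler_pdivrMr// mulrC.
  rewrite ler_pM2r// /m -!natrM ler_nat; lia.
have E : (8 * k + 7 = k + ((6 * k + 7) + k))%N by lia.
have window (z : R[i]) j : (j < 6 * k + 7)%N -> 3 * kappa <= Im z -> Im z <= 5 * kappa ->
    `|cauchy_point z (8 * k + 7) (k + j) - Re z| <= 5 * A * kappa.
  move=> jk zl zu; rewrite /cauchy_point addrAC subrr add0r normrN normrM.
  rewrite ger0_norm; last lra.
  apply: (@le_trans _ _ (5 * kappa * A)); last by rewrite mulrAC.
  apply: ler_pM => //; first lra.
  exact: central_slope.
have split_sum z : \sum_(j < 8 * k + 7) delta (cauchy_point z (8 * k + 7) j) =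
    \sum_(j < k) delta (cauchy_point z (8 * k + 7) j) +
    (\sum_(j < 6 * k + 7) delta (cauchy_point z (8 * k + 7) (k + j)) +
     \sum_(j < k) delta (cauchy_point z (8 * k + 7) (k + (6 * k + 7 + j)))).
  have gen (f : nat -> R) n : n = (k + ((6 * k + 7) + k))%N ->
      \sum_(j < n) f j = \sum_(j < k) f j + (\sum_(j < 6 * k + 7) f (k + j)%N +
        \sum_(j < k) f (k + (6 * k + 7 + j))%N) by move=> ->; rewrite !big_split_ord.
  exact: (gen (fun j => delta (cauchy_point z (8 * k + 7) j)) _ E).
have outer (f : nat -> R) : `|\sum_(j < k) delta (f j)| <= k%:R * D.
  rewrite (le_trans (ler_norm_sum _ _ _))// mulr_natl -[k in _ *+ k]card_ord.
  by rewrite -sumr_const; apply: ler_sum => j _; exact: hD.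
have zbounds (w z : R[i]) : Im w = 4 * kappa -> cnorm (z - w) <= kappa ->
    [/\ 3 * kappa <= Im z, Im z <= 5 * kappa, Re w - kappa <= Re z &
      Re z <= Re w + kappa].
  move=> Imw zw; have := le_trans (ler_Im_cnorm _) zw.
  have := le_trans (ler_Re_cnorm _) zw.
  rewrite ImB ReB Imw !ler_norml => /andP[? ?] /andP[? ?].
  by split; lra.
pose l := (2 + 10 * A) * kappa.
rewrite ler_norml; apply/andP; split.
- pose w : R[i] := (x - kappa - 5 * A * kappa) +i* (4 * kappa).
  have [z zw pz] := close (erefl : Im w = 4 * kappa).
  have [z3 z5 xl xu] := zbounds w z erefl zw; rewrite /= in xl xu.
  have := sum_distance_le k z3 pz; rewrite split_sum ler_norml => /andP[hl _].
  have := outer (fun j => cauchy_point z (8 * k + 7) j).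
  have := outer (fun j => cauchy_point z (8 * k + 7) (k + (6 * k + 7 + j))%N).
  have inner : \sum_(j < 6 * k + 7) delta (cauchy_point z (8 * k + 7) (k + j)) <=
      m * (delta x + l).
    rewrite /m mulr_natl -[X in _ *+ X]card_ord -sumr_const; apply: ler_sum => j _.
    have := window z j (ltn_ord j) z3 z5; rewrite ler_norml.
    set q := cauchy_point _ _ _ => /andP[q1 q2].
    have qx : q <= x by lra.
    have := distrib_fun_le mu qx; have := om_lip qx.
    have : x - q <= l by rewrite /l; lra.
    lra.
  rewrite !ler_norml => /andP[_ u1] /andP[_ u2].
  have : m * (- (D / 3 + (7 + 10 * A) * kappa)) <= m * delta x.
    have -> : m * (- (D / 3 + (7 + 10 * A) * kappa)) =
      - (m * (D / 3)) - m * (5 * kappa) - m * l by rewrite /l; ring.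
    by move: inner; rewrite mulrDr; lra.
  by rewrite ler_pM2l.
pose w : R[i] := (x + kappa + 5 * A * kappa) +i* (4 * kappa).
have [z zw pz] := close (erefl : Im w = 4 * kappa).
have [z3 z5 xl xu] := zbounds w z erefl zw; rewrite /= in xl xu.
have := sum_distance_le k z3 pz; rewrite split_sum ler_norml => /andP[_ hl].
have := outer (fun j => cauchy_point z (8 * k + 7) j).
have := outer (fun j => cauchy_point z (8 * k + 7) (k + (6 * k + 7 + j))%N).
have inner : m * (delta x - l) <=
    \sum_(j < 6 * k + 7) delta (cauchy_point z (8 * k + 7) (k + j)).
  rewrite /m mulr_natl -[X in _ *+ X]card_ord -sumr_const; apply: ler_sum => j _.
  have := window z j (ltn_ord j) z3 z5; rewrite ler_norml.
  set q := cauchy_point _ _ _ => /andP[q1 q2].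
  have qx : x <= q by lra.
  have := distrib_fun_le mu qx; have := om_lip qx.
  have : q - x <= l by rewrite /l; lra.
  lra.
rewrite !ler_norml => /andP[u1 _] /andP[u2 _].
have : m * delta x <= m * (D / 3 + (7 + 10 * A) * kappa).
  have -> : m * (D / 3 + (7 + 10 * A) * kappa) =
    m * (D / 3) + m * (5 * kappa) + m * l by rewrite /l; ring.
  by move: inner; rewrite mulrBr; lra.
by rewrite ler_pM2l.
Qed.

(** The improvement is iterated from the trivial bound 1. *)
Lemma distrib_fun_close x : `|delta x| <= (12 + 15 * A) * kappa.
Proof.
have k0 := kappa0; have A_ge0 := A0.
have it n y : `|delta y| <= 3^-1 ^+ n + (21 / 2 + 15 * A) * kappa.
  elim: n y => [|n IH] y.
    apply: (@le_trans _ _ 1); last by rewrite expr0 lerDl mulr_ge0 ?ltW//; lra.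
    exact: distrib_fun_dist_le1.
  apply: le_trans (improve y IH) _; rewrite exprS; lra.
have [|N0 hN] := @geometric_eventually_le R 3^-1 kappa _ k0; first lra.
have := hN N0 (leqnn _); have := it N0 x; lra.
Qed.

End smoothing.

(** * Cumulants of a normalized free sum *)

Section moments.
Context {R : realType}.
Local Notation prob := (probability (measurableTypeR R) R).
Local Notation cpoly := (map_poly (real_complex R)).

Lemma state_horner_alg (A : tracial_space R) (x : A) (nu : prob) M
  (nuM : carried nu M) (q : {poly R}) : has_distribution x nu ->
  state A (horner_alg x (cpoly q)) = (poly_expect nuM q)%:C.
Proof.
move=> [_ mom].
have momE k : state A (x ^+ k) = (poly_expect nuM 'X^k)%:C.
  rewrite mom /poly_expect; congr (_%:C).
  have -> : (fun t : R => ('X^k : {poly R}).[t]) = (fun t => t ^+ k).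
    by apply/funext => t; rewrite hornerXn.
  apply: expect_setT => //.
  have := admissible_horner M ('X^k : {poly R}).
  by congr admissible; apply/funext => t; rewrite hornerXn.
rewrite -[q]coefK poly_def rmorph_sum rmorph_sum !linear_sum rmorph_sum/=.
apply: eq_bigr => k _.
rewrite map_polyZ linearZ/= map_polyXn rmorphXn/= horner_algX mulr_algl linearZ/= momE.
by rewrite linearZ/= rmorphM.
Qed.

Variables (nu : prob) (sigma T : R).
Hypothesis T0 : 0 < T.
Hypothesis nuT : carried nu T.
Hypothesis nuE : 'E_nu[fun x => x]%E = 0%E.
Hypothesis nuV : 'V_nu[fun x => x]%E = (sigma ^+ 2)%:E.
Local Notation E := (poly_expect nuT).

Lemma poly_expect_mean : E 'X = 0.
Proof.
rewrite /poly_expect -(expect_setT nuT); last exact: admissible_horner.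
rewrite /Rintegral; under eq_integral do rewrite hornerX.
by move: nuE; rewrite unlock => ->.
Qed.

Lemma poly_expect_variance : E ('X * 'X) = sigma ^+ 2.
Proof.
rewrite /poly_expect -(expect_setT nuT); last exact: admissible_horner.
rewrite /Rintegral; under eq_integral do rewrite hornerM hornerX.
move: nuV; rewrite /variance unlock nuE /= unlock => h.
rewrite -[RHS]/(fine (sigma ^+ 2)%:E) -h; congr fine; apply: eq_integral => t _.
by congr EFin; rewrite mulrfctE /= !subr0.
Qed.

Let weighted_le (q : {poly R}) C : (forall t, `|t| <= T -> `|q.[t]| <= C) ->
  `|E ('X * ('X * q))| <= sigma ^+ 2 * C.
Proof.
move=> qC; have aX := admissible_horner T ('X * 'X : {poly R}).
rewrite -poly_expect_variance [leRHS]mulrC /poly_expect -expectZ//.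
apply: le_trans (ler_norm_expect nuT (admissible_horner _ _)) _.
apply: expect_le => //.
- by apply: admissible_norm; exact: admissible_horner.
- by apply: admissibleM => //; exact: admissible_cst.
move=> t tT; rewrite !hornerM hornerX mulrA normrM mulrC.
rewrite [X in _ * X]ger0_norm -?expr2 ?sqr_ge0// ler_wpM2r ?sqr_ge0//.
exact: qC.
Qed.

Lemma variance_le : sigma ^+ 2 <= T ^+ 2.
Proof.
rewrite -poly_expect_variance (le_trans (ler_norm _))// /poly_expect.
apply: expect_norm_le => //; first exact: admissible_horner.
move=> t tT; rewrite hornerM hornerX normrM expr2.
by rewrite ler_pM.
Qed.

Lemma distribution_cumulant_le k :
  `|free_cumulant E k| <= sigma ^+ 2 / (2 * T) * (4 * T) ^+ k.
Proof.
apply: free_cumulant_le => //; first exact: sqr_ge0.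
- exact: variance_le.
- exact: poly_expect_mean.
Qed.

Lemma distribution_cumulant0 : free_cumulant E 0 = 0.
Proof. by rewrite free_cumulantE cumulant_poly0 mulr1; exact: poly_expect_mean. Qed.

Lemma distribution_cumulant1 : free_cumulant E 1 = sigma ^+ 2.
Proof.
rewrite free_cumulantE cumulant_polyS big_ord1 distribution_cumulant0 scale0r subr0.
by rewrite cumulant_poly0 mulr1; exact: poly_expect_variance.
Qed.

End moments.

Section free_sum.
Context {R : realType} {A : tracial_space R}.
Local Notation prob := (probability (measurableTypeR R) R).
Local Notation cpoly := (map_poly (real_complex R)).
Variables (X : nat -> A) (nu : nat -> prob) (T : nat -> R) (n : nat) (B : R).
Hypothesis freeX : freely_independent X.
Hypothesis distX : forall i, has_distribution (X i) (nu i).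
Hypothesis nuT : forall i, carried (nu i) (T i).

(** Free cumulants add up, and dividing by B scales the one of index k, which has
    degree k + 1. *)
Definition sum_cumulant k : R :=
  (\sum_(i < n) free_cumulant (poly_expect (nuT i)) k) * B^-1 ^+ k.+1.

Let p i k := cpoly (cumulant_poly (free_cumulant (poly_expect (nuT i))) k).

Let p_null i k : state A (horner_alg (X i) (p i k.+1)) = 0.
Proof.
rewrite (state_horner_alg (nuT i))//.
by have /= -> := @free_cumulant_null _ (poly_expect (nuT i)) k (poly_expect1 (nuT i)).
Qed.

Let p0 i : horner_alg (X i) (p i 0) = 1.
Proof. by rewrite /p cumulant_poly0 rmorph1 rmorph1. Qed.

Let pS i k : X i * horner_alg (X i) (p i k) = horner_alg (X i) (p i k.+1) +
  \sum_(j < k.+1) (free_cumulant (poly_expect (nuT i)) j)%:C *: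
    horner_alg (X i) (p i (k - j)).
Proof.
rewrite -{1}[X i]horner_algX -rmorphM/=.
have -> : 'X * p i k = cpoly ('X * cumulant_poly (free_cumulant (poly_expect (nuT i))) k).
  by rewrite rmorphM/= map_polyX.
rewrite mulX_cumulant_poly !rmorphD/= !rmorph_sum/=; congr (_ + _).
by apply: eq_bigr => j _; rewrite map_polyZ linearZ/= mulr_algl.
Qed.

Let S : A := (B^-1)%:C *: \sum_(i < n) X i.

Let horner_sum_cumulant k : horner_alg S (cpoly (cumulant_poly sum_cumulant k)) =
  ((B^-1) ^+ k)%:C *: all_words X n p k.
Proof.
have W0 : all_words X n p 0 = 1.
  by rewrite /all_words big1 ?addr0// => j _; rewrite /words/= big_ord0.
have WS := @all_wordsS _ _ X n p
  (fun i j => (free_cumulant (poly_expect (nuT i)) j)%:C) p0 pS.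
have [m] := ubnP k; elim: m k => // m IH [|k] km.
  by rewrite cumulant_poly0 W0 expr0 !rmorph1 scale1r.
rewrite cumulant_polyS !rmorphB/= !rmorphM/= map_polyX horner_algX IH//.
rewrite WS scalerBr; congr (_ - _).
  by rewrite /S -scalerAl -scalerAr scalerA -rmorphM/= exprS.
rewrite !rmorph_sum/= scaler_sumr; apply: eq_bigr => j _.
have jk : (j <= k)%N by rewrite -ltnS.
rewrite map_polyZ linearZ/= mulr_algl IH; last by lia.
rewrite !scalerA -rmorph_sum -!rmorphM/=; congr (_%:C *: _).
rewrite /sum_cumulant -mulrA mulrC -exprD; congr (_ ^+ _ * _).
by lia.
Qed.

(** Up to powers of B the polynomials of the summed cumulants, taken at the
    normalized sum, are the sums of all centred alternating words. *)
Lemma sum_cumulant_null (mu : prob) M (muM : carried mu M) k :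
  has_distribution S mu ->
  poly_expect muM (cumulant_poly sum_cumulant k.+1) = 0.
Proof.
move=> dS; have := state_horner_alg muM (cumulant_poly sum_cumulant k.+1) dS.
rewrite horner_sum_cumulant linearZ/= state_all_words// mulr0.
by move=> /(congr1 (fun x => Re x)) /= <-.
Qed.

End free_sum.

Section sum_cumulant_decay.
Context {R : realType}.
Local Notation prob := (probability (measurableTypeR R) R).
Variables (nu : nat -> prob) (sigma T : nat -> R) (n : nat).
Hypothesis n0 : (0 < n)%N.
Hypothesis nuT : forall i, carried (nu i) (T i).
Hypothesis nuE : forall i, 'E_(nu i)[fun x => x]%E = 0%E.
Hypothesis s0 : forall i, 0 < sigma i.
Hypothesis nuV : forall i, 'V_(nu i)[fun x => x]%E = (sigma i ^+ 2)%:E.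
Hypothesis T0 : forall i, 0 < T i.
Local Notation B := (Num.sqrt (\sum_(i < n) sigma i ^+ 2)).
Local Notation L := ((\sum_(i < n) T i ^+ 3) / B ^+ 3).

Let sum_gt0 (f : nat -> R) : (forall i, 0 < f i) -> 0 < \sum_(i < n) f i.
Proof.
move=> f0; case: n n0 => // m _; rewrite big_ord_recl ltr_wpDr// sumr_ge0// => i _.
exact: ltW.
Qed.

Lemma normalization_gt0 : 0 < B.
Proof.
rewrite sqrtr_gt0; apply: (sum_gt0 (f := fun i => sigma i ^+ 2)) => i.
by rewrite exprn_gt0.
Qed.

Lemma lyapunov_gt0 : 0 < L.
Proof.
rewrite divr_gt0 ?exprn_gt0 ?normalization_gt0//.
by apply: (sum_gt0 (f := fun i => T i ^+ 3)) => i; rewrite exprn_gt0.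
Qed.

(** If L is at most 32 ^ -3 then every T i / B is at most 1/32, which turns the
    geometric growth of the cumulants of each summand into decay. *)
Lemma sum_cumulant_near : L <= 32^-1 ^+ 3 ->
  near_semicircular (sum_cumulant n B nuT) (8 ^+ 3 * L).
Proof.
move=> L1; have B0 := normalization_gt0; have L0 := lyapunov_gt0.
have tau i : (i < n)%N -> 0 <= T i / B <= 32^-1.
  move=> ilt; have t0 : 0 <= T i / B by rewrite divr_ge0 ?(ltW B0) ?(ltW (T0 i)).
  rewrite t0 -(@ler_pXn2r _ 3)// ?nnegrE//.
  apply: le_trans L1; rewrite expr_div_n; apply: ler_wpM2r.
    by rewrite invr_ge0 exprn_ge0// ltW.
  rewrite (bigD1 (Ordinal ilt))//= lerDl sumr_ge0// => j _.
  by rewrite exprn_ge0// ltW.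
split.
- rewrite mulr_ge0 ?(ltW L0)//=.
  apply: le_trans (ler_wpM2l _ L1) _ => //.
  by rewrite -exprMn exprn_ile1//; lra.
- by rewrite /sum_cumulant big1 ?mul0r// => i _; exact: distribution_cumulant0.
- rewrite /sum_cumulant (eq_bigr (fun i : 'I_n => sigma i ^+ 2)); last first.
    by move=> i _; apply: distribution_cumulant1.
  rewrite -[X in X * _](@sqr_sqrtr _ (\sum_(i < n) sigma i ^+ 2)); last first.
    by rewrite sumr_ge0// => i _; rewrite sqr_ge0.
  by rewrite -exprMn mulfV ?expr1n// lt0r_neq0.
move=> k k1; rewrite /sum_cumulant normrM [`|B^-1 ^+ _|]ger0_norm; last first.
  by rewrite exprn_ge0// invr_ge0 ltW.
apply: (@le_trans _ _ (\sum_(i < n) 8 ^+ 3 * (T i ^+ 3 / B ^+ 3) * 8^-1 ^+ k)); last first.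
  by rewrite -mulr_suml -mulr_sumr -mulr_suml.
apply: le_trans (ler_wpM2r _ (ler_norm_sum _ _ _)) _.
  by rewrite exprn_ge0// invr_ge0 ltW.
rewrite mulr_suml; apply: ler_sum => i _.
have c := distribution_cumulant_le (T0 i) (nuT i) (nuE i) (nuV i) k.
have v := variance_le (nuT i) (nuE i) (nuV i).
apply: le_trans (ler_wpM2r _ c) _.
  by rewrite exprn_ge0// invr_ge0 ltW.
have /andP[t0 t1] := tau i (ltn_ord i).
apply: (@le_trans _ _ (T i ^+ 2 / (2 * T i) * (4 * T i) ^+ k * B^-1 ^+ k.+1)).
  do 3!(apply: ler_wpM2r; first by
    rewrite ?invr_ge0 ?exprn_ge0 ?invr_ge0 ?mulr_ge0 ?ltW).
  exact: v.
case: k k1 {c} => [|[|k]]// _.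
have -> : T i ^+ 2 / (2 * T i) * (4 * T i) ^+ k.+2 * B^-1 ^+ k.+3 =
    8 * (T i ^+ 3 / B ^+ 3) * (4 * (T i / B)) ^+ k.
  rewrite !exprMn !exprS !expr0 !exprVn; field.
  by rewrite expf_neq0 ?lt0r_neq0.
have -> : 8 ^+ 3 * (T i ^+ 3 / B ^+ 3) * 8^-1 ^+ k.+2 =
    8 * (T i ^+ 3 / B ^+ 3) * 8^-1 ^+ k by rewrite !exprS; field; rewrite lt0r_neq0.
apply: ler_wpM2l.
  by rewrite mulr_ge0// divr_ge0// exprn_ge0// ltW.
move: t0 t1; move: (T i / B) => y y0 y1.
by rewrite lerXn2r ?nnegrE ?mulr_ge0//; lra.
Qed.

End sum_cumulant_decay.

Theorem theorem1p7 (R : realType) :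
  exists2 c : R, 0 < c &
    forall (A : tracial_space R) (X : nat -> A)
      (nu : nat -> probability (measurableTypeR R) R) (sigma T : nat -> R),
    (forall i, self_adjoint (X i)) ->
    freely_independent X ->
    (forall i, has_distribution (X i) (nu i)) ->
    (forall i, 'E_(nu i)[fun x => x]%E = 0%E) ->
    (forall i, 0 < sigma i) ->
    (forall i, 'V_(nu i)[fun x => x]%E = (sigma i ^+ 2)%:E) ->
    (forall i, 0 < T i) ->
    (forall i, msupport (nu i) `<=` `[- T i, T i]) ->
    forall n : nat, (0 < n)%N ->
    let B : R := Num.sqrt (\sum_(i < n) sigma i ^+ 2) in
    let S : A := (B^-1)%:C *: \sum_(i < n) X i in
    let L : R := (\sum_(i < n) T i ^+ 3) / B ^+ 3 in
    forall mu : probability (measurableTypeR R) R,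
    has_distribution S mu ->
    (kolmogorov_distance mu (@semicircle R) <= (c * L)%:E)%E.
Proof.
pose K : R := (12 + 15 * `|tan (3 / 8 * pi)|) * 8 ^+ 3.
have K0 : 0 <= K by rewrite mulr_ge0// addr_ge0// mulr_ge0.
exists (K + 32 ^+ 3); first by rewrite ltr_wpDl.
move=> A X nu sigma T _ freeX distX nuE s0 nuV T0 supp n n0 B S L mu distS.
have nuT i : carried (nu i) (T i) by apply: carried_msupport; exact: supp.
have [M _ muM] := carried_distribution distS.
have L0 : 0 < L by by apply: (@lyapunov_gt0 R sigma T n).
have dist_le x : `|distrib_fun mu x - distrib_fun (@semicircle R) x| <= (K + 32 ^+ 3) * L.
  (* For large L the bound exceeds 1. *)
  have [L1|L1] := leP L (32^-1 ^+ 3); last first.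
    apply: le_trans (distrib_fun_dist_le1 _ _ _) _.
    have h : 1 <= 32 ^+ 3 * L.
      by rewrite -ler_pdivrMl ?exprn_gt0// mulr1 -exprVn ltW.
    by rewrite mulrDl (le_trans h)// lerDr mulr_ge0// ltW.
  have near := sum_cumulant_near n0 nuT nuE s0 nuV T0 L1.
  have k0 : 0 < 8 ^+ 3 * L by rewrite mulr_gt0// exprn_gt0.
  have null k := @sum_cumulant_null _ _ X nu T n B freeX distX nuT mu M muM k distS.
  have := @distrib_fun_close _ mu (@semicircle R) M 2 (8 ^+ 3 * L) muM (@carried_semicircle R)
    (@semicircle_cdf_lipschitz R) k0
    (@potential_close _ _ _ (@carried_semicircle R) (@expect_chebyshev R)
      mu M _ _ muM near null k0) x.
  move=> /le_trans; apply; rewrite mulrA ler_wpM2r ?(ltW L0)//.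
  apply: (@le_trans _ _ K); last by rewrite lerDl exprn_ge0.
  by rewrite ler_wpM2r ?exprn_ge0// lerD2l ler_wpM2l// ler_norm.
apply: ge_ereal_sup => _ [x _ <-].
have fin (P : probability (measurableTypeR R) R) :
    P `]-oo, x]%classic = (distrib_fun P x)%:E by rewrite /distrib_fun fineK// fin_num_measure.
by rewrite !fin -EFinB lee_fin dist_le.
Qed.
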